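(* Let $m,n$ be positive integers satisfying $\{m,n\}\notin\{\{1,1\},\{2,3\}\}$. Then $FS_{m,n}\neq\emptyset$. In fact $$\dim_H FS_{m,n}\ \ge\ mn-2\max\{m,n\}.$$ Moreover, both claims remain true when $FS_{m,n}$ is replaced by the subset of those matrices in $FS_{m,n}$ that have full $\mathbb{R}$-rank $\min\{m,n\}$.
   Context: Everything is with respect to maximum norms $\|\cdot\|_\infty$ on $\mathbb{R}^n$ and $\mathbb{R}^m$. For $\Omega\in\mathbb{R}^{m\times n}$ and $t\ge1$ let $$\psi_\Omega^{m\times n}(t)=\min\{\|\Omega\hat{\boldsymbol b}+\tilde{\boldsymbol b}\|_\infty:\hat{\boldsymbol b}\in\mathbb{Z}^n,\ \tilde{\boldsymbol b}\in\mathbb{Z}^m,\ 1\le\|\hat{\boldsymbol b}\|_\infty\le t\},$$ $\Theta(\Omega)=\limsup_{t\to\infty}t^{n/m}\psi_\Omega^{m\times n}(t)$, $\widetilde\Theta(\Omega)=\liminf_{t\to\infty}t^{n/m}\psi_\Omega^{m\times n}(t)$, and $D=\sup_{\Omega\in\mathbb{R}^{m\times n}}\Theta(\Omega)$ (which equals $1$). Put $Di_{m,n}=\{\Omega:\Theta(\Omega)<D\}$, $Sing_{m,n}=\{\Omega:\Theta(\Omega)=0\}$, $Bad_{m,n}=\{\Omega:\widetilde\Theta(\Omega)>0\}$, and $FS_{m,n}=Di_{m,n}\setminus(Bad_{m,n}\cup Sing_{m,n})$. $\dim_H$ denotes Hausdorff dimension in $\mathbb{R}^{m\times n}\cong\mathbb{R}^{mn}$.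 *)

(* Defs.v *)
From HB Require Import structures.
From mathcomp Require Import all_boot all_order all_algebra.
From mathcomp Require Import all_classical all_reals all_analysis.

Set Implicit Arguments.
Unset Strict Implicit.
Unset Printing Implicit Defensive.

Import Order.TTheory GRing.Theory Num.Theory.
Import numFieldNormedType.Exports.

Local Open Scope classical_set_scope.
Local Open Scope ring_scope.

(* In a normed space V; on matrices 'M[R]_(m, n) the norm `|_| of
   MathComp-Analysis is the maximum norm of the entries. *)
Section hausdorff_dimension.
Context {R : realType} {V : normedModType R}.

Definition diam (U : set V) : \bar R :=
  ereal_sup [set `|z.1 - z.2|%:E | z in U `*` U].

(* diam(U)^s, with the usual conventions that the empty set contributes 0
   and that 0^0 = 1, so that the 0-dimensional measure counts points.
   The diameter of the empty set as defined above is -oo. *)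
Definition diam_pow (s : R) (U : set V) : \bar R :=
  if U == set0 then 0%E else (diam U `^ s)%E.

Definition hausdorff_premeasure (s delta : R) (A : set V) : \bar R :=
  ereal_inf [set (\sum_(0 <= i <oo) diam_pow s (U i))%E
    | U in [set U : nat -> set V |
        A `<=` \bigcup_i U i /\ forall i, (diam (U i) <= delta%:E)%E]].

Definition hausdorff_measure (s : R) (A : set V) : \bar R :=
  ereal_sup [set hausdorff_premeasure s delta A
    | delta in [set delta : R | 0 < delta]].

Definition hausdorff_dim (A : set V) : \bar R :=
  ereal_inf [set s%:E
    | s in [set s : R | 0 <= s /\ hausdorff_measure s A = 0%E]].

End hausdorff_dimension.

Section uniform_approximation.
Context {R : realType} {m n : nat}.
Implicit Types Omega : 'M[R]_(m, n).

(* For t >= 1 the infimum below is a minimum: there are finitely many bhat,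
   and for each of them the norm tends to infinity with btilde. *)
Definition psi Omega (t : R) : R :=
  inf [set `|Omega *m map_mx intr b.1 + map_mx intr b.2|
    | b in [set b : 'cV[int]_n * 'cV[int]_m |
        1 <= `|map_mx intr b.1 : 'cV[R]_n| <= t]].

Definition scaled_psi Omega (t : R) : \bar R :=
  (t `^ (n%:R / m%:R) * psi Omega t)%:E.

Definition Theta_sup Omega : \bar R :=
  limf_esup (scaled_psi Omega) (pinfty_nbhs R).

Definition Theta_inf Omega : \bar R :=
  limf_einf (scaled_psi Omega) (pinfty_nbhs R).

End uniform_approximation.

Section approximation_sets.
Variables (R : realType) (m n : nat).

Definition dirichlet_const : \bar R := ereal_sup (range (@Theta_sup R m n)).

Definition Di : set 'M[R]_(m, n) :=
  [set Omega | (Theta_sup Omega < dirichlet_const)%E].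

Definition Sing : set 'M[R]_(m, n) := [set Omega | Theta_sup Omega = 0%E].

Definition Bad : set 'M[R]_(m, n) := [set Omega | (0 < Theta_inf Omega)%E].

Definition FS : set 'M[R]_(m, n) := Di `\` (Bad `|` Sing).

Definition FS_full_rank : set 'M[R]_(m, n) :=
  FS `&` [set Omega | \rank Omega = minn m n].

End approximation_sets.

Arguments Di : clear implicits.
Arguments Sing : clear implicits.
Arguments Bad : clear implicits.
Arguments FS : clear implicits.
Arguments FS_full_rank : clear implicits.

(* Main.v *)
Require Import Defs.
From HB Require Import structures.
From mathcomp Require Import all_boot all_order all_algebra.
From mathcomp Require Import all_classical all_reals all_analysis.
From mathcomp Require Import zify ring lra.

(** Theta (Omega) is unchanged when an integer matrix is added to Omega, and it
    suffices to find, for every eps > 0, matrices with 0 < Theta < eps and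
    liminf 0: these first show D > 0 and then, with eps small compared with D,
    lie in FS. Such an Omega is built as [A | X], where A has one or two columns
    only. The columns of A alone already give psi_A (t) <= eps t^(-n/m) for all
    large t and liminf 0, and both pass to [A | X]; moreover
    psi_A (t) >= c t^(-n/m) along a sequence of t. For generic X the last bound
    survives, with a smaller c, along a subsequence: at a given scale, the X
    violating it occupy at most half of every fixed cube. Hence the admissible X
    have full dimension m (n - #columns of A) >= m n - 2 max (m, n).

    A is a limit of dyadic matrices. It is one column when n < m, a diagonal
    2 x 2 block bordered by zeros when 2 <= m <= n, and a row (alpha, beta) when
    m = 1 < n. For the full rank one adds a large integer multiple of the
    partial identity. *)

Set Implicit Arguments.
Unset Strict Implicit.
Unset Printing Implicit Defensive.

Import Order.TTheory GRing.Theory Num.Theory.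
Import numFieldNormedType.Exports.

Local Open Scope classical_set_scope.
Local Open Scope ring_scope.

(** * Approximation at the scales t = 2 ^ (m x) *)

Section height.
Variable R : realType.

(** The upper bound on psi is required at all large scales, the other two conditions only along
    sequences; the upper bound therefore dictates the shape of A. A single column with an irrational
    entry has limsup of t psi_A (t) at least 1/2, which excludes small eps when n >= m, and a
    rational column loses the lower bound. For n < m one column has room enough. Otherwise two
    columns relieve each other: one serves on the scales where the other fails. With two rows they
    can be kept independent; with a single row they add up in the same coordinate and have to be
    coupled.

    Dyadic entries turn the lower bound into divisibility: a nonzero residue is at least the inverse
    of the denominator, and a vanishing one forces, the numerators being odd, a high power of 2 to
    divide the integer vector.

    Having half of every cube at suitable scales is enough for full dimension: a countable cover of
    small weight cannot be heavy on all subcubes of one half, so nested subcubes lead to an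
    admissible X outside the cover. *)

Lemma mx_norm_leP m n (M : 'M[R]_(m, n)) (r : R) : 0 <= r ->
  (`|M| <= r) <-> (forall i j, `|M i j| <= r).
Proof.
move=> r0; rewrite [`|M|]/Num.Def.normr /= mx_normrE; split => [|H].
  by move=> /bigmax_leP[_ H] i j; exact: (H (i, j)).
by apply/bigmax_leP; split => // -[i j] _; exact: H.
Qed.

Lemma mx_entry_le m n (M : 'M[R]_(m, n)) i j : `|M i j| <= `|M|.
Proof. by move: i j; apply/(mx_norm_leP M (normr_ge0 M)). Qed.

Lemma mx_entry_normE m n (M : 'M[R]_(m, n)) : M != 0 ->
  exists i j, `|M| = `|M i j|.
Proof.
move=> M0; have [|[i j] e] := @mx_norm_neq0 _ _ _ M; first by rewrite (normr_eq0 M).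
by exists i, j.
Qed.

Definition height k (b : 'cV[int]_k) : nat := \max_i `|b i ord0|%N.

Lemma height_leP k (b : 'cV[int]_k) K :
  (height b <= K)%N <-> (forall i, (`|b i ord0| <= K)%N).
Proof.
split => [H i|H]; last by apply/bigmax_leqP => i _; exact: H.
by apply: leq_trans H; exact: (@leq_bigmax _ (fun i => `|b i ord0|%N)).
Qed.

Lemma height_gt0 k (b : 'cV[int]_k) : (0 < height b)%N = (b != 0).
Proof.
apply/idP/idP => [|/eqP b0].
  apply: contraTneq => ->; rewrite -leqNgt; apply/height_leP => i.
  by rewrite mxE.
rewrite lt0n; apply/eqP => h0; apply: b0; apply/matrixP => i j.
rewrite (ord1 j) mxE; apply/eqP; rewrite -absz_eq0 -leqn0.
by apply: (height_leP b 0).1; rewrite h0.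
Qed.

Lemma norm_intr (z : int) : `|z%:~R| = (`|z|%N)%:R :> R.
Proof. by rewrite -intr_norm -abszE. Qed.

Lemma norm_map_intr k (b : 'cV[int]_k) :
  `|map_mx intr b : 'cV[R]_k| = (height b)%:R.
Proof.
apply/eqP; rewrite eq_le; apply/andP; split.
  apply/mx_norm_leP => // i j; rewrite !mxE (ord1 j) norm_intr ler_nat.
  exact: (height_leP b (height b)).1.
case: k b => [|k] b; first by rewrite /height big_ord0 normr_ge0.
have [i hi] : exists i, height b = `|b i ord0|%N.
  by have [|i hi] := @bigop.eq_bigmax _ (fun i => `|b i ord0|%N); [rewrite card_ord|exists i].
by rewrite hi -norm_intr; have := mx_entry_le (map_mx intr b : 'cV[R]__) i 0;
  rewrite mxE.
Qed.

End height.

Section special_matrices.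
Variables (R : realType).
Implicit Types (m n k x : nat) (eps : R).

Definition residue m k (A : 'M[R]_(m, k)) (b : 'cV[int]_k) (a : 'cV[int]_m) : R :=
  `|A *m map_mx intr b + map_mx intr a|.

(* The scales are t = 2 ^ (m x), for which t ^ (n / m) = 2 ^ (n x); the
   exponent n is independent of the number k of columns. *)
Definition covered m n k eps (x : nat) (A : 'M[R]_(m, k)) :=
  exists b a, [/\ (0 < height b)%N, (height b <= 2 ^ (m * x))%N &
    residue A b a * 2 ^+ (n * x.+1) <= eps].

Definition well_approx m n k eps (x : nat) (A : 'M[R]_(m, k)) :=
  exists b a, [/\ (0 < height b)%N, (height b <= 2 ^ (m * x))%N &
    residue A b a * 2 ^+ (n * x) <= eps].

Definition separated m n k (c : R) (x : nat) (A : 'M[R]_(m, k)) :=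
  forall b a, (0 < height b)%N -> (height b <= 2 ^ (m * x))%N ->
    c <= residue A b a * 2 ^+ (n * x).

(** For [k = n] the clauses give in turn that Theta is at most [eps], that [A] is not in [Bad] and
    that Theta is positive, which is membership in [FS] once [eps] lies below the Dirichlet
    constant. *)
Definition special m n k eps (A : 'M[R]_(m, k)) :=
  [/\ exists x0, forall x, (x0 <= x)%N -> covered n eps x A,
      forall eta x0, 0 < eta -> exists2 x, (x0 <= x)%N & well_approx n eta x A &
      exists2 c, 0 < c &
        forall x0, exists2 x, (x0 <= x)%N & separated n c x A].

Lemma residue_ge0 m k (A : 'M[R]_(m, k)) b a : 0 <= residue A b a.
Proof. exact: normr_ge0. Qed.

End special_matrices.

Section Theta_special.
Variables (R : realType) (m n : nat).
Hypothesis m_gt0 : (0 < m)%N.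
Implicit Type A : 'M[R]_(m, n).

Lemma scale_powR (x : nat) :
  (2 ^+ (m * x) : R) `^ (n%:R / m%:R) = 2 ^+ (n * x).
Proof.
rewrite -powR_mulrn // -powRrM -powR_mulrn //; congr (_ `^ _).
rewrite !natrM; have mR : (m%:R : R) != 0 by rewrite pnatr_eq0 -lt0n.
by field.
Qed.

Lemma psi_le A b a (t : R) : (0 < height b)%N -> (height b)%:R <= t ->
  psi A t <= residue A b a.
Proof.
move=> b0 bt; apply: ge_inf.
  by exists 0 => _ [z _ <-]; exact: normr_ge0.
exists (b, a) => //=; rewrite norm_map_intr; apply/andP; split => //.
by rewrite ler1n.
Qed.

Lemma le_psi A (t c : R) : (0 < n)%N -> 1 <= t ->
  (forall b a, (0 < height b)%N -> (height b)%:R <= t -> c <= residue A b a) ->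
  c <= psi A t.
Proof.
move=> n0 t1 H; apply: lb_le_inf.
  exists (residue A (const_mx 1) 0); exists (const_mx 1, 0) => //=.
  have -> : `|map_mx intr (const_mx 1) : 'cV[R]_n| = 1.
    rewrite norm_map_intr; suff -> : height (const_mx 1 : 'cV[int]_n) = 1%N by [].
    apply/eqP; rewrite eqn_leq; apply/andP; split.
      by apply/height_leP => i; rewrite mxE.
    rewrite height_gt0; apply/eqP => /matrixP/(_ (Ordinal n0) 0).
    by rewrite !mxE.
  by rewrite lexx.
move=> _ [[b a] /= /andP[b1 bt] <-]; apply: H.
  by move: b1; rewrite norm_map_intr ler1n.
by move: bt; rewrite norm_map_intr.
Qed.

Lemma psi_ge0 A t : 0 <= psi A t.
Proof.
have [[u Su]|S0] := pselect ([set `|A *m map_mx intr b.1 + map_mx intr b.2|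
    | b in [set b : 'cV[int]_n * 'cV[int]_m |
        1 <= `|map_mx intr b.1 : 'cV[R]_n| <= t]] !=set0).
  by apply: lb_le_inf; [exists u|move=> _ [z _ <-]; exact: normr_ge0].
(* An empty index set, as for [t < 1], gives the default value 0 of [inf]. *)
by rewrite /psi inf_out // => -[].
Qed.

Lemma dyadic_scale (t : R) (x0 : nat) : 2 ^+ (m * x0) <= t ->
  exists2 x, (x0 <= x)%N & 2 ^+ (m * x) <= t <= 2 ^+ (m * x.+1).
Proof.
move=> tx0; have t0 : 0 <= t by apply: le_trans tx0; rewrite exprn_ge0.
pose P x := (2 ^+ (m * x) : R) <= t.
have Pb x : P x -> (x <= Num.bound t)%N.
  move=> Px; have : (x%:R : R) < (Num.bound t)%:R.
    apply: le_lt_trans (archi_boundP t0); apply: le_trans Px.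
    rewrite -natrX ler_nat; apply: (@leq_trans (2 ^ x)).
      exact/ltnW/ltn_expl.
    by rewrite leq_exp2l // leq_pmull.
  by rewrite ltr_nat => /ltnW.
have [x Px mx] := ex_maxnP (ex_intro P x0 tx0) Pb.
exists x; first exact: mx.
apply/andP; split => //; rewrite leNgt; apply/negP => /ltW/mx.
by rewrite ltnn.
Qed.

(** One vector serves for all t from [2 ^ (m x)] to [2 ^ (m (x + 1))]: its height is at most the
    left end, and [covered] uses the scale factor of the right end, whence the [x.+1] there. *)
Lemma Theta_sup_le A eps (x0 : nat) : 
  (forall x, (x0 <= x)%N -> covered n eps x A) -> (Theta_sup A <= eps%:E)%E.
Proof.
move=> H; rewrite /Theta_sup limf_esupE; apply: ge_ereal_inf.
exists (ereal_sup (scaled_psi A @` [set t | 2 ^+ (m * x0) < t])).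
  exists [set t | 2 ^+ (m * x0) < t] => //.
  by exists (2 ^+ (m * x0)); split => //; exact: num_real.
apply: ge_ereal_sup => _ [t /= /ltW tx <-]; rewrite lee_fin.
have [x x0x /andP[xt tx1]] := dyadic_scale tx.
have [b [a [b0 bx ba]]] := H x x0x.
apply: le_trans ba; rewrite mulrC; apply: ler_pM.
- exact: psi_ge0.
- exact: powR_ge0.
- apply: psi_le => //; apply: le_trans xt; rewrite -natrX ler_nat //.
- rewrite -scale_powR; apply: ge0_ler_powR => //.
  + by rewrite nnegrE; apply: le_trans xt; rewrite exprn_ge0.
  + by rewrite nnegrE exprn_ge0.
Qed.

Lemma le_Theta_sup A (c : R) : (0 < n)%N ->
  (forall x0, exists2 x, (x0 <= x)%N & separated n c x A) ->
  (c%:E <= Theta_sup A)%E.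
Proof.
move=> n0 H; rewrite /Theta_sup limf_esupE; apply: le_ereal_inf_tmp.
move=> _ [S [M [_ MS]] <-].
have [x xM sx] := H (Num.bound `|M|).
apply: le_ereal_sup_tmp; exists (scaled_psi A (2 ^+ (m * x))).
  exists (2 ^+ (m * x)) => //; apply: MS.
  apply: le_lt_trans (ler_norm M) _; apply: lt_le_trans (archi_boundP _) _ => //.
  rewrite -natrX ler_nat; apply: leq_trans xM _; apply: (@leq_trans (2 ^ x)).
    exact/ltnW/ltn_expl.
  by rewrite leq_exp2l // leq_pmull.
rewrite /scaled_psi scale_powR lee_fin mulrC -ler_pdivrMr ?exprn_gt0 //.
apply: le_psi => //; first by rewrite exprn_ege1 // ler1n.
move=> b a b0 bx; rewrite ler_pdivrMr ?exprn_gt0 //; apply: sx => //.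
by move: bx; rewrite -natrX ler_nat.
Qed.

Lemma Theta_inf_le0 A :
  (forall eta x0, 0 < eta -> exists2 x, (x0 <= x)%N & well_approx n eta x A) ->
  (Theta_inf A <= 0)%E.
Proof.
move=> H; rewrite /Theta_inf limf_einfE; apply: ge_ereal_sup.
move=> _ [S [M [_ MS]] <-].
apply/lee_addgt0Pr => eta eta0; rewrite add0e.
have [x xM [b [a [b0 bx ba]]]] := H eta (Num.bound `|M|) eta0.
apply: ge_ereal_inf; exists (scaled_psi A (2 ^+ (m * x))).
  exists (2 ^+ (m * x)) => //; apply: MS.
  apply: le_lt_trans (ler_norm M) _; apply: lt_le_trans (archi_boundP _) _ => //.
  rewrite -natrX ler_nat; apply: leq_trans xM _; apply: (@leq_trans (2 ^ x)).
    exact/ltnW/ltn_expl.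
  by rewrite leq_exp2l // leq_pmull.
rewrite /scaled_psi scale_powR lee_fin mulrC; apply: le_trans ba.
rewrite ler_pM2r ?exprn_gt0 //; apply: psi_le => //.
by rewrite -natrX ler_nat.
Qed.

End Theta_special.

(** * Limits of nested stages *)

Section nested.
Variable R : realType.

(** The hypothesis on [c] says that each interval contains the next one. The radii need not tend to
    0; the supremum of the left ends is a common point. *)
Lemma nested_intervals (c r : nat -> R) : (forall j, 0 <= r j) ->
  (forall j, `|c j.+1 - c j| <= r j - r j.+1) ->
  exists x, forall j, `|x - c j| <= r j.
Proof.
move=> r0 H.
have lo i j : c i - r i <= c (i + j)%N - r (i + j)%N.
  elim: j => [|j IH]; first by rewrite addn0.
  apply: le_trans IH _; rewrite addnS; move: (H (i + j)%N).
  by rewrite ler_norml => /andP[]; lra.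
have up i j : c (i + j)%N + r (i + j)%N <= c i + r i.
  elim: j => [|j IH]; first by rewrite addn0.
  apply: le_trans IH; rewrite addnS; move: (H (i + j)%N).
  by rewrite ler_norml => /andP[]; lra.
have lu i j : c i - r i <= c j + r j.
  have [ij|/ltnW ji] := leqP i j.
    by have := lo i (j - i)%N; rewrite subnKC //; have := r0 j; lra.
  by have := up j (i - j)%N; rewrite subnKC //; have := r0 i; lra.
pose S := [set c i - r i | i in [set: nat]].
have supS : has_sup S.
  split; first by exists (c 0%N - r 0%N), 0%N.
  by exists (c 0%N + r 0%N) => _ [i _ <-]; exact: lu.
exists (sup S) => j; rewrite ler_norml; apply/andP; split.
  have : c j - r j <= sup S by apply: ub_le_sup; [exact: supS.2|exists j].
  lra.
have : sup S <= c j + r j.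
  by apply: ge_sup; [exact: supS.1|move=> _ [i _ <-]; exact: lu].
lra.
Qed.

Lemma nested_balls m n (c : nat -> 'M[R]_(m, n)) (r : nat -> R) :
  (forall j, 0 <= r j) -> (forall j, `|c j.+1 - c j| <= r j - r j.+1) ->
  exists A, forall j, `|A - c j| <= r j.
Proof.
move=> r0 H.
have /choice[f fP] : forall i : 'I_m, exists f : 'I_n -> R,
    forall l j, `|f l - c j i l| <= r j.
  move=> i; have /choice[f fP] : forall l : 'I_n, exists x,
      forall j, `|x - c j i l| <= r j.
    move=> l; apply: nested_intervals => // j; apply: le_trans (H j).
    by have := mx_entry_le (c j.+1 - c j) i l; rewrite !mxE.
  by exists f.
exists (\matrix_(i, l) f i l) => j; apply/mx_norm_leP => // i l.
by rewrite !mxE; exact: fP.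
Qed.

Lemma norm_mulmx_intr m k (B : 'M[R]_(m, k)) (b : 'cV[int]_k) :
  `|B *m map_mx intr b| <= k%:R * `|B| * (height b)%:R.
Proof.
apply/mx_norm_leP; first by rewrite !mulr_ge0.
move=> i j; rewrite !mxE; apply: le_trans (ler_norm_sum _ _ _) _.
have -> : k%:R * `|B| * (height b)%:R = \sum_(l < k) `|B| * (height b)%:R.
  by rewrite sumr_const card_ord -mulrA mulr_natl.
apply: ler_sum => l _; rewrite normrM; apply: ler_pM => //.
  exact: mx_entry_le.
rewrite -(norm_map_intr R b); have := mx_entry_le (map_mx intr b : 'cV[R]_k) l j.
by [].
Qed.

Lemma residue_lip m k (A B : 'M[R]_(m, k)) b a :
  residue A b a <= residue B b a + k%:R * `|A - B| * (height b)%:R.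
Proof.
rewrite /residue.
have -> : A *m map_mx intr b + map_mx intr a =
  (B *m map_mx intr b + map_mx intr a) + (A - B) *m map_mx intr b.
  by rewrite mulmxBl [RHS]addrC addrA subrK.
by apply: le_trans (ler_normD _ _) _; rewrite lerD2l norm_mulmx_intr.
Qed.

Definition stage m n k (eps eta c : R) (y y' : nat) (A : 'M[R]_(m, k)) :=
  [/\ forall x, (y <= x < y')%N -> covered n eps x A,
      exists2 x, (y <= x < y')%N & well_approx n eta x A &
      exists2 x, (y <= x < y')%N & separated n c x A].

(** Only the finitely many scales below [y'] enter a stage, so heights and scale factors are bounded
    and a small change of [A] costs at most [delta]. *)
Lemma stage_open m n k (eps eta c delta : R) (y y' : nat) (A : 'M[R]_(m, k)) :
  0 < delta -> stage n eps eta c y y' A ->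
  exists2 rho, 0 < rho & forall B, `|B - A| <= rho ->
    stage n (eps + delta) (eta + delta) (c - delta) y y' B.
Proof.
move=> d0 [cA wA sA].
(* Bounds the product of number of columns, height and scale factor; [k.+1] keeps it positive when
   there are no columns. *)
pose M : R := k.+1%:R * 2 ^+ (m * y') * 2 ^+ (n * y'.+1).
have M0 : 0 < M by rewrite !mulr_gt0 ?exprn_gt0.
exists (delta / M); first exact: divr_gt0.
move=> B BA.
have err (b : 'cV[int]_k) x e : (height b <= 2 ^ (m * x))%N -> (x < y')%N -> (e <= y'.+1)%N ->
    k%:R * `|B - A| * (height b)%:R * 2 ^+ (n * e) <= delta.
  move=> bx xy ey; apply: (@le_trans _ _ (M * `|B - A|)); last first.
    by rewrite mulrC -ler_pdivlMr.
  have -> : k%:R * `|B - A| * (height b)%:R * 2 ^+ (n * e) =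
      k%:R * (height b)%:R * 2 ^+ (n * e) * `|B - A| by ring.
  apply: ler_wpM2r => //; apply: ler_pM; rewrite ?mulr_ge0 ?exprn_ge0 //.
    apply: ler_pM => //; first by rewrite ler_nat.
    rewrite -natrX ler_nat; apply: leq_trans bx _.
    by rewrite leq_exp2l // leq_mul2l (ltnW xy) orbT.
  by rewrite ler_weXn2l ?ler1n // leq_mul2l ey orbT.
split.
- move=> x xy; have [b [a [b0 bx ba]]] := cA x xy.
  case/andP: xy => _ xy; exists b, a; split => //.
  refine (le_trans _ (lerD ba (err b x x.+1 bx xy (ltnW xy)))).
  by rewrite -mulrDl ler_wpM2r ?exprn_ge0 // residue_lip.
- have [x xy [b [a [b0 bx ba]]]] := wA; exists x => //.
  case/andP: xy => _ xy; exists b, a; split => //.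
  refine (le_trans _ (lerD ba (err b x x bx xy (leqW (ltnW xy))))).
  by rewrite -mulrDl ler_wpM2r ?exprn_ge0 // residue_lip.
- have [x xy sx] := sA; exists x => // b a b0 bx.
  rewrite lerBlDr; apply: le_trans (sx b a b0 bx) _.
  have := err b x x bx; case/andP: (xy) => _ xy'.
  move=> /(_ xy' (leqW (ltnW xy'))) H; refine (le_trans _ (lerD (lexx _) H)).
  rewrite -mulrDl ler_wpM2r ?exprn_ge0 //; have := residue_lip A B b a.
  by rewrite -normrN opprB.
Qed.

(** [I A y] is the invariant of the iteration: in the applications [A] is dyadic and some vector
    admissible at scale [y] has residue 0. Since the next matrix can be taken arbitrarily close,
    every finished stage survives all later steps. *)
Lemma exists_special m n k (eps c : R) (I : 'M[R]_(m, k) -> nat -> Prop) A0 y0 :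
  0 < eps -> 0 < c -> I A0 y0 ->
  (forall A y rho, I A y -> 0 < rho -> exists A' y', [/\ (y < y')%N, I A' y',
     `|A' - A| <= rho & stage n eps (2 ^- y) c y y' A']) ->
  exists2 A, `|A - A0| <= 1 & special n (2 * eps) A.
Proof.
move=> eps0 c0 I0 step.
pose T := {z : 'M[R]_(m, k) * R * nat | I z.1.1 z.2 /\ 0 < z.1.2}.
pose ctr (s : T) := (sval s).1.1; pose rad (s : T) := (sval s).1.2.
pose lvl (s : T) := (sval s).2.
have rad0 s : 0 < rad s by case: s => z [].
have Is s : I (ctr s) (lvl s) by case: s => z [].
have /choice[f fP] : forall s : T, exists s' : T, [/\ (lvl s < lvl s')%N,
    `|ctr s' - ctr s| <= rad s - rad s' & forall B, `|B - ctr s'| <= rad s' ->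
      stage n (2 * eps) (2 ^- (lvl s) *+ 2) (c / 2) (lvl s) (lvl s') B].
  move=> s.
  have [A' [y' [yy' I' AA' sA']]] := step _ _ _ (Is s) (divr_gt0 (rad0 s) (ltr0Sn R 1)).
  (* The loss allowed to all later steps: [eps] and [2 ^- y] at most double, [c] is at most
     halved. *)
  pose delta := Num.min eps (Num.min (2 ^- (lvl s)) (c / 2)).
  have d0 : 0 < delta.
    by rewrite !lt_min eps0 invr_gt0 exprn_gt0 // divr_gt0.
  have [rho rho0 H] := stage_open d0 sA'.
  (* The centre moves by at most half of the old radius and the new radius is at most the other
     half, so the balls are nested. *)
  pose r' := Num.min rho (rad s / 2).
  have r'0 : 0 < r' by rewrite lt_min rho0 divr_gt0.
  exists (exist _ (A', r', y') (conj I' r'0)); split => //.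
    have : r' <= rad s / 2 by rewrite ge_min lexx orbT.
    by move: AA'; rewrite /ctr /rad /=; lra.
  move=> B BA; have [|h1 h2 h3] := H B.
    by apply: le_trans BA _; rewrite ge_min lexx.
  have de : delta <= eps by rewrite ge_min lexx.
  have dy : delta <= 2 ^- (lvl s) by rewrite !ge_min lexx orbT.
  have dc : delta <= c / 2 by rewrite !ge_min lexx !orbT.
  split.
  - move=> x /h1[b [a [? ? ba]]]; exists b, a; split => //.
    by apply: le_trans ba _; lra.
  - have [x xy [b [a [? ? ba]]]] := h2; exists x => //; exists b, a; split => //.
    by apply: le_trans ba _; rewrite mulr2n lerD2l.
  - have [x xy sx] := h3; exists x => // b a b0 bx.
    by apply: le_trans (sx b a b0 bx); lra.
pose s j := iter j f (exist _ (A0, 1, y0) (conj I0 ltr01) : T).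
have [A HA] : exists A, forall j, `|A - ctr (s j)| <= rad (s j).
  apply: nested_balls => j; first exact/ltW/rad0.
  by have [] := fP (s j).
exists A; first exact: (HA 0%N).
pose y j := lvl (s j).
have ylt j : (y j < y j.+1)%N by have [] := fP (s j).
have yge j : (j <= y j)%N.
  by elim: j => // j IH; exact: leq_trans (ylt j).
have stg j : stage n (2 * eps) (2 ^- y j *+ 2) (c / 2) (y j) (y j.+1) A.
  by have [_ _] := fP (s j); apply; exact: (HA j.+1).
split.
- exists y0 => x xy.
  have [j yj mj] := ex_maxnP (ex_intro (fun j => y j <= x)%N 0%N xy)
    (fun j h => leq_trans (yge j) h).
  have [H _ _] := stg j; apply: H; rewrite yj /= ltnNge; apply/negP => /mj.
  by rewrite ltnn.
- move=> eta x0 eta0.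
  have [j0 Hj0] : exists j0, 2 ^- j0 *+ 2 <= eta.
    exists (Num.bound (2 / eta)); set N := Num.bound _.
    have -> : 2 ^- N *+ 2 = 2 / 2 ^+ N :> R by rewrite [RHS]mulr_natl.
    rewrite ler_pdivrMr ?exprn_gt0 // mulrC -ler_pdivrMr //.
    apply/ltW/(lt_le_trans (archi_boundP _)); first by rewrite divr_ge0 // ltW.
    by rewrite -natrX ler_nat; exact/ltnW/ltn_expl.
  have [_ [x xy wx] _] := stg (maxn x0 j0); exists x.
    apply: leq_trans (leq_maxl x0 j0) _; apply: leq_trans (yge _) _.
    by case/andP: xy.
  have [b [a [b0 bx ba]]] := wx; exists b, a; split => //.
  apply: le_trans ba _; apply: le_trans Hj0; rewrite lerMn2r /=.
  rewrite lef_pV2 ?posrE ?exprn_gt0 // ler_weXn2l ?ler1n //.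
  by apply: leq_trans (leq_maxr x0 j0) _; exact: yge.
- exists (c / 2); first exact: divr_gt0.
  move=> x0; have [_ _ [x xy sx]] := stg x0; exists x => //.
  by apply: leq_trans (yge x0) _; case/andP: xy.
Qed.

End nested.

(** * Dyadic numbers and divisibility by powers of 2 *)

Section dyadic.
Variable R : realType.

Lemma residue_leP m k (A : 'M[R]_(m, k)) (b : 'cV[int]_k) (a : 'cV[int]_m) r : 0 <= r ->
  (residue A b a <= r) <->
  (forall i, `|\sum_j A i j * (b j ord0)%:~R + (a i ord0)%:~R| <= r).
Proof.
move=> r0; rewrite /residue mx_norm_leP //; split => [H i|H i j].
  have := H i ord0; rewrite !mxE; congr (`|_ + _| <= _).
  by apply: eq_bigr => j _; rewrite mxE.
rewrite (ord1 j) !mxE; have := H i; congr (`|_ + _| <= _).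
by apply: eq_bigr => l _; rewrite mxE.
Qed.

Lemma residue_entry m k (A : 'M[R]_(m, k)) (b : 'cV[int]_k) (a : 'cV[int]_m) i :
  `|\sum_j A i j * (b j ord0)%:~R + (a i ord0)%:~R| <= residue A b a.
Proof. exact: (residue_leP A b a (residue_ge0 A b a)).1. Qed.

Lemma exp2_intr g : (2 ^+ g : int)%:~R = 2 ^+ g :> R.
Proof. by rewrite rmorphXn. Qed.

Lemma exp2_split (a b : nat) : (a <= b)%N -> 2 ^+ b = 2 ^+ a * 2 ^+ (b - a) :> R.
Proof. by move=> ab; rewrite -exprD subnKC. Qed.

Lemma exp2_neq0 g : (2 ^+ g : R) != 0.
Proof. by rewrite expf_neq0. Qed.

Lemma exp2N_le (a b : nat) : (a <= b)%N -> 2 ^- b <= 2 ^- a :> R.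
Proof.
by move=> ab; rewrite lef_pV2 ?posrE ?exprn_gt0 // ler_weXn2l // ler1n.
Qed.

Lemma exp2N_arbitrarily_small (rho : R) : 0 < rho ->
  exists N, forall x, (N <= x)%N -> 2 ^- x <= rho.
Proof.
move=> rho0; exists (Num.bound rho^-1) => x Nx; apply: le_trans (exp2N_le Nx) _.
rewrite -[leRHS]invrK lef_pV2 ?posrE ?exprn_gt0 ?invr_gt0 //.
apply/ltW/(lt_le_trans (archi_boundP _)); first by rewrite invr_ge0 ltW.
by rewrite -natrX ler_nat; exact/ltnW/ltn_expl.
Qed.

Lemma ler_intr_norm (d z : int) : d <= `|z| -> d%:~R <= `|z%:~R| :> R.
Proof. by rewrite -intr_norm ler_int. Qed.

Lemma dvdz_small (d z : int) : (d %| z)%Z -> `|z| < d -> z = 0.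
Proof.
move=> /dvdzP[q ->]; have [->|q0] := eqVneq q 0; first by rewrite mul0r.
by move=> H; exfalso; nia.
Qed.

Lemma odd_dvd_exp2 (P b : int) g : odd `|P| ->
  (2 ^+ g %| b * P)%Z -> (2 ^+ g %| b)%Z.
Proof.
move=> oP; rewrite Gauss_dvdzl //.
by apply: coprimezXl; rewrite coprimezE coprime2n.
Qed.

End dyadic.

(** * The dyadic constructions *)

Section rows.
Variable R : realType.

Lemma odd_mul_exp2D (P Q : int) k : (0 < k)%N -> odd `|P| ->
  odd `|Q * 2 ^+ k + P|.
Proof.
move=> k0 oP; suff : ~~ (2 %| Q * 2 ^+ k + P)%Z.
  by rewrite dvdzE dvdn2 negbK.
have h : (2 %| Q * 2 ^+ k)%Z by apply/dvdz_mull/dvdz_exp.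
by rewrite rpredDl // dvdzE dvdn2 oP.
Qed.

Lemma exp2_quot_le (a b c L : nat) : (a + c + L <= b)%N ->
  2 ^+ a / 2 ^+ b * 2 ^+ c <= 2 ^- L :> R.
Proof.
move=> H; rewrite mulrAC -exprD ler_pdivrMr ?exprn_gt0 // mulrC.
rewrite ler_pdivlMr ?exprn_gt0 // -exprD; apply: ler_weXn2l => //.
by rewrite ler1n.
Qed.

Lemma exp2_quot_ge (a b c d : nat) : (b <= a + c + d)%N ->
  2 ^- d <= 2 ^+ a / 2 ^+ b * 2 ^+ c :> R.
Proof.
move=> H; rewrite mulrAC -exprD ler_pdivlMr ?exprn_gt0 // mulrC.
rewrite ler_pdivrMr ?exprn_gt0 // -exprD; apply: ler_weXn2l => //.
by rewrite ler1n.
Qed.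

Definition pair_col (x y : int) : 'cV[int]_2 := \col_i (if i == ord0 then x else y).

Lemma height_pair_col x y K : (`|x| <= K)%N -> (`|y| <= K)%N ->
  (height (pair_col x y) <= K)%N.
Proof. by move=> hx hy; apply/height_leP => i; rewrite mxE; case: ifP. Qed.

Lemma height_pair_col_gt0 x y : (x != 0) || (y != 0) ->
  (0 < height (pair_col x y))%N.
Proof.
rewrite height_gt0; apply: contraL => /eqP/matrixP H.
have := H ord0 ord0; have := H (lift ord0 ord0) ord0; rewrite !mxE /= => -> ->.
by rewrite eqxx.
Qed.

Lemma height_le_coord k (b : 'cV[int]_k) K i : (height b <= K)%N ->
  `|b i ord0| <= K%:Z.
Proof. by move=> /height_leP/(_ i); rewrite -abszE lez_nat. Qed.

Lemma height2_neq0 (b : 'cV[int]_2) : (0 < height b)%N ->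
  b ord0 ord0 = 0 -> b (lift ord0 ord0) ord0 != 0.
Proof.
rewrite height_gt0 => + b0; apply: contraNneq => b1; apply/eqP/matrixP => i j.
rewrite (ord1 j) mxE; case: (unliftP ord0 i) => [l|] -> //.
by rewrite (ord1 l).
Qed.

Definition row2 (al be : R) : 'M[R]_(1, 2) :=
  \matrix_(i, j) (if j == ord0 then al else be).

Lemma row2_sum al be i (v : 'I_2 -> R) :
  \sum_j row2 al be i j * v j = al * v ord0 + be * v (lift ord0 ord0).
Proof. by rewrite !big_ord_recl big_ord0 addr0 !mxE. Qed.

Definition dyadic_row (A : 'M[R]_(1, 2)) (y : nat) := exists P Q : int,
  odd `|P| /\ A = row2 (P%:~R / 2 ^+ y) (Q%:~R / 2 ^+ y).

(* The vectors (2 ^ y, 0), (1, 2 ^ s) and (0, 2 ^ (s + y)) successively realize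
   the upper bound; subtracting 2 ^- s * al from be makes the second one cancel
   al up to its next digit. *)
Lemma step_row n L A y rho : (2 <= n)%N -> (1 <= L)%N -> dyadic_row A y ->
  0 < rho -> exists A' y', [/\ (y < y')%N, dyadic_row A' y',
     `|A' - A| <= rho &
     stage n (2 ^- L) (2 ^- y) (2 ^- (n + L)) y y' A'].
Proof.
move=> n2 L1 [P [Q [oP ->]]] rho0.
set al := P%:~R / _; set be := Q%:~R / _.
have [N HN] : exists N, forall x, (N <= x)%N -> 2 ^- x <= rho / (`|al| + 1) :> R.
  by apply: exp2N_arbitrarily_small; rewrite divr_gt0 // ltr_wpDl.
(* [N] makes both changes smaller than [rho]. The vector [(1, 2 ^ s)] will have residue [2 ^- h']
   and must serve up to scale [h], where the factor is [2 ^ (n h)]; this determines [h']. *)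
pose s := (N + (y + y).+1)%N; pose h := (s + y)%N; pose h' := (n * h + L)%N.
have ys : (y + y < s)%N by rewrite /s; lia.
have hh' : (h + h < h')%N by rewrite /h'; nia.
pose al' := al + 2 ^- h'; pose be' := be - 2 ^- s * al.
have al'E : al' = (P * 2 ^+ (h' - y) + 1)%:~R / 2 ^+ h'.
  have e : 2 ^+ h' = 2 ^+ y * 2 ^+ (h' - y) :> R by apply: exp2_split; lia.
  rewrite /al' /al intrD intrM exp2_intr e.
  by have := exp2_neq0 R y; have := exp2_neq0 R (h' - y) => ? ?; field; apply/andP.
have be'E : be' = (Q * 2 ^+ s - P)%:~R / 2 ^+ h.
  rewrite /be' /be /al intrB intrM exp2_intr /h exprD.
  by have := exp2_neq0 R y; have := exp2_neq0 R s => ? ?; field; apply/andP.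
have oQ : odd (absz (Q * 2 ^+ s - P)%R) by apply: odd_mul_exp2D; rewrite ?abszN; lia.
have be'E' : be' = ((Q * 2 ^+ s - P) * 2 ^+ (h' - h))%:~R / 2 ^+ h'.
  have e : 2 ^+ h' = 2 ^+ h * 2 ^+ (h' - h) :> R by apply: exp2_split; lia.
  rewrite be'E intrM exp2_intr e.
  by have := exp2_neq0 R h; have := exp2_neq0 R (h' - h) => ? ?; field; apply/andP.
have res_le (b : 'cV[int]_2) (a : 'cV[int]_1) (r : R) : 0 <= r ->
    `|al' * (b ord0 ord0)%:~R + be' * (b (lift ord0 ord0) ord0)%:~R
      + (a ord0 ord0)%:~R| <= r -> residue (row2 al' be') b a <= r.
  by move=> r0 H; apply/residue_leP => // i; rewrite row2_sum (ord1 i).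
exists (row2 al' be'), h'; split.
- by rewrite /h'; lia.
- exists (P * 2 ^+ (h' - y) + 1), ((Q * 2 ^+ s - P) * 2 ^+ (h' - h)).
  by split; [apply: odd_mul_exp2D; lia | rewrite -al'E -be'E'].
- have s_small : 2 ^- s * (`|al| + 1) <= rho.
    by rewrite -ler_pdivlMr ?ltr_wpDl //; apply: HN; rewrite /s; lia.
  apply/mx_norm_leP; first exact: ltW.
  move=> i j; rewrite !mxE; case: ifP => _; rewrite addrAC subrr add0r; last first.
    rewrite normrN normrM ger0_norm ?invr_ge0 ?exprn_ge0 //.
    by apply: le_trans s_small; rewrite ler_wpM2l ?invr_ge0 ?exprn_ge0 // lerDl.
  rewrite ger0_norm ?invr_ge0 ?exprn_ge0 //; apply: le_trans s_small.
  apply: (@le_trans _ _ (2 ^- s)); first by apply: exp2N_le; lia.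
  by rewrite ler_peMr ?invr_ge0 ?exprn_ge0 // lerDr.
- have cov1 x : (y <= x)%N -> exists b a, [/\ (0 < height b)%N,
      (height b <= 2 ^ (1 * x))%N & residue (row2 al' be') b a <= 2 ^+ y / 2 ^+ h'].
    move=> yx; exists (pair_col (2 ^+ y) 0), (const_mx (- P)).
    split; first by apply: height_pair_col_gt0; rewrite expf_neq0.
      by apply: height_pair_col => //; rewrite abszX mul1n leq_exp2l.
    apply: res_le; first by rewrite divr_ge0 ?exprn_ge0.
    rewrite !mxE /= mulr0 addr0 exp2_intr /al' /al mulrDl mulrVK ?unitfE ?exp2_neq0 //.
    by rewrite mulrNz addrAC subrr add0r mulrC ger0_norm // divr_ge0 ?exprn_ge0.
split.
+ move=> x /andP[yx xh']; have [xs|sx] := ltnP x s; last have [xh|hx] := ltnP x h.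
  * have [b [a [b0 bx ba]]] := cov1 x yx; exists b, a; split => //.
    apply: le_trans (ler_wpM2r _ ba) _; first by rewrite exprn_ge0.
    by apply: exp2_quot_le; rewrite /h' /h; nia.
  * exists (pair_col 1 (2 ^+ s)), (const_mx (- (Q * 2 ^+ (s - y)))).
    split; first by apply: height_pair_col_gt0.
      by apply: height_pair_col; rewrite ?abszX mul1n ?leq_exp2l ?expn_gt0.
    apply: (@le_trans _ _ (2 ^+ 0 / 2 ^+ h' * 2 ^+ (n * x.+1))); last first.
      by apply: exp2_quot_le; rewrite /h'; nia.
    apply: ler_wpM2r; first by rewrite exprn_ge0.
    apply: res_le; first by rewrite divr_ge0 ?exprn_ge0.
    rewrite !mxE /= mulr1 mulrNz intrM !exp2_intr.
    have e : 2 ^+ s = 2 ^+ y * 2 ^+ (s - y) :> R by apply: exp2_split; lia.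
    have -> : al' + be' * 2 ^+ s - Q%:~R * 2 ^+ (s - y) = 2 ^+ 0 / 2 ^+ h'.
      rewrite /al' /be' /be e expr0.
      have := exp2_neq0 R y; have := exp2_neq0 R (s - y).
      by have := exp2_neq0 R h' => ? ? ?; field; apply/and3P.
    by rewrite ger0_norm // divr_ge0 ?exprn_ge0.
  * exists (pair_col 0 (2 ^+ h)), (const_mx (- (Q * 2 ^+ s - P))).
    split; first by apply: height_pair_col_gt0; rewrite expf_neq0 ?orbT.
      by apply: height_pair_col => //; rewrite abszX mul1n leq_exp2l.
    apply: (@le_trans _ _ 0); last by rewrite invr_ge0 exprn_ge0.
    rewrite pmulr_lle0 ?exprn_gt0 //; apply: res_le => //.
    rewrite !mxE /= mulr0 add0r be'E exp2_intr mulrNz mulrVK ?unitfE ?exp2_neq0 //.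
    by rewrite subrr normr0.
+ exists y; first by rewrite leqnn /=; lia.
  have [b [a [b0 bx ba]]] := cov1 y (leqnn y); exists b, a; split => //.
  apply: le_trans (ler_wpM2r _ ba) _; first by rewrite exprn_ge0.
  by apply: exp2_quot_le; rewrite /h' /h; nia.
(* Scale [h - 1] is the last one at which [(0, 2 ^ h)] is too high. No residue vanishes there, so
   all are at least [2 ^- h'], and [h' - n (h - 1) = n + L] gives the constant. *)
+ exists h.-1; first by apply/andP; split; lia.
  move=> b a b0 bx.
  apply: (@le_trans _ _ (2 ^+ 0 / 2 ^+ h' * 2 ^+ (n * h.-1))).
    by apply: exp2_quot_ge; rewrite /h'; nia.
  apply: ler_wpM2r; first by rewrite exprn_ge0.
  apply: le_trans (residue_entry _ _ _ ord0); rewrite row2_sum al'E be'E'.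
  set b1 := b ord0 ord0; set b2 := b _ ord0; set a0 := a ord0 ord0.
  (* [K] is the numerator over [2 ^ h] for [al] and [be']; the digit added to [al] contributes [b1].
     As [|b1| < 2 ^ h <= 2 ^ (h' - h)], [X = 0] forces [K = b1 = 0], and then the odd numerator of
     [be'] makes [2 ^ h] divide [b2]. *)
  pose K := b1 * P * 2 ^+ s + b2 * (Q * 2 ^+ s - P) + a0 * 2 ^+ h.
  pose X := K * 2 ^+ (h' - h) + b1.
  rewrite (_ : _ + _ = X%:~R / 2 ^+ h'); last first.
    have e1 : 2 ^+ (h' - y) = 2 ^+ s * 2 ^+ (h' - h) :> R.
      by rewrite -exprD; congr (_ ^+ _); rewrite /h; lia.
    have e2 : 2 ^+ h' = 2 ^+ h * 2 ^+ (h' - h) :> R by apply: exp2_split; lia.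
    rewrite /X /K !(intrD, intrM, intrB, mulrNz) !exp2_intr e1 e2.
    have := exp2_neq0 R h; have := exp2_neq0 R (h' - h) => ? ?.
    by field; apply/andP.
  rewrite normrM normfV (ger0_norm (exprn_ge0 h' _)) //.
  rewrite ler_wpM2r ?invr_ge0 ?exprn_ge0 // expr0.
  suff X0 : X != 0 by apply: (@ler_intr_norm R 1 X); rewrite -gtz0_ge1 normr_gt0.
  have bh i : `|b i ord0| < 2 ^+ h.
    apply: le_lt_trans (height_le_coord i bx) _.
    by rewrite -natz natrX ltr_eXn2l // mul1n; lia.
  apply/eqP => X0; have K0 : K = 0.
    apply/eqP; apply: contraT => K0; exfalso.
    have : 2 ^+ (h' - h) <= `|b1|.
      have -> : b1 = - (K * 2 ^+ (h' - h)) by apply/eqP; rewrite -addr_eq0 addrC -/X X0.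
      by rewrite normrN normrM [leRHS]mulrC normrX ler_peMr ?exprn_ge0 // -gtz0_ge1 normr_gt0.
    apply/negP; rewrite -ltNge; apply: lt_le_trans (bh ord0) _.
    by apply: ler_weXn2l => //; lia.
  have b10 : b1 = 0 by move: X0; rewrite /X K0 mul0r add0r.
  have := height2_neq0 b0 b10; apply/negP; rewrite negbK; apply/eqP.
  apply: dvdz_small (bh _); apply: odd_dvd_exp2 oQ _.
  apply/dvdzP; exists (- a0); move: K0; rewrite /K b10 !mul0r add0r -/b2.
  by move/eqP; rewrite addr_eq0 mulNr => /eqP.
Qed.

Lemma exists_special_row n L : (2 <= n)%N -> (1 <= L)%N ->
  exists A : 'M[R]_(1, 2), special n (2 * 2 ^- L) A.
Proof.
move=> n2 L1.
have I0 : dyadic_row (row2 1 0) 0.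
  by exists 1, 0; split => //; rewrite expr0 !divr1.
have [|||A _ spA] := @exists_special R 1 n 2 (2 ^- L) (2 ^- (n + L)) _ _ _ _ _ I0.
- by rewrite invr_gt0 exprn_gt0.
- by rewrite invr_gt0 exprn_gt0.
- by move=> A y rho; exact: step_row.
- by exists A.
Qed.

End rows.

(** * Diagonal blocks, for at least two rows and at least as many columns as rows *)

Section diagonal.
Variables (R : realType) (m : nat).

Definition diag2 (al be : R) : 'M[R]_(m.+2, 2) :=
  \matrix_(i, j) (if i == ord0 then if j == ord0 then al else 0
    else if (i == 1 :> nat) && (j != ord0) then be else 0).

Let i1 : 'I_m.+2 := lift ord0 ord0.

Lemma diag2_sum0 al be (v : 'I_2 -> R) :
  \sum_j diag2 al be ord0 j * v j = al * v ord0.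
Proof. by rewrite !big_ord_recl big_ord0 !mxE /= mul0r !addr0. Qed.

Lemma diag2_sum1 al be (v : 'I_2 -> R) :
  \sum_j diag2 al be i1 j * v j = be * v (lift ord0 ord0).
Proof. by rewrite !big_ord_recl big_ord0 !mxE /= mul0r add0r addr0. Qed.

Lemma diag2_sumS al be i (v : 'I_2 -> R) : i != ord0 -> i != i1 ->
  \sum_j diag2 al be i j * v j = 0.
Proof.
move=> n0 n1; apply: big1 => j _; rewrite mxE (negPf n0).
by rewrite -[X in _ == X]/(i1 : nat) (negPf n1 : (i == i1 :> nat) = false) mul0r.
Qed.

Lemma residue_diag2_le al be (b : 'cV[int]_2) (a : 'cV[int]_m.+2) r : 0 <= r ->
  (forall i, i != ord0 -> i != i1 -> a i ord0 = 0) ->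
  `|al * (b ord0 ord0)%:~R + (a ord0 ord0)%:~R| <= r ->
  `|be * (b (lift ord0 ord0) ord0)%:~R + (a i1 ord0)%:~R| <= r ->
  residue (diag2 al be) b a <= r.
Proof.
move=> r0 a0 h0 h1; apply/residue_leP => // i.
have [->|n0] := eqVneq i ord0; first by rewrite diag2_sum0.
have [->|n1] := eqVneq i i1; first by rewrite diag2_sum1.
by rewrite diag2_sumS // a0 // add0r normr0.
Qed.

(** The bound on [g] makes [(2 ^ g, 0)], whose residue is 0, admissible from scale [y] on. *)
Definition dyadic_diag (A : 'M[R]_(m.+2, 2)) (y : nat) := exists (P Q : int) g,
  [/\ odd `|P|, (g <= m.+2 * y)%N & A = diag2 (P%:~R / 2 ^+ g) (Q%:~R / 2 ^+ g)].

(* Each column alone only controls an interval of scales; the digits of al and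
   be are interlaced so that these intervals cover everything. *)
Lemma step_diag n L A y rho : (m.+2 <= n)%N -> (1 <= L)%N -> dyadic_diag A y ->
  0 < rho -> exists A' y', [/\ (y < y')%N, dyadic_diag A' y',
     `|A' - A| <= rho &
     stage n (2 ^- L) (2 ^- y) (2 ^- (n + L)) y y' A'].
Proof.
move=> mn L1 [P [Q [g [oP gy ->]]]] rho0.
set al := P%:~R / _; set be := Q%:~R / _.
have [N HN] := exp2N_arbitrarily_small rho0.
(* From scale [z] on, [(0, 2 ^ f)] has residue 0. Before, [(2 ^ g, 0)] must serve with residue
   [2 ^ g / 2 ^ g'], and [g' - g = n z + L] is what scale [z] requires. It exceeds [f], since
   [m.+2 <= n] and [1 <= L]. *)
pose z := (N + (y + y).+1)%N; pose f := (m.+2 * z)%N.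
pose g' := (n * z + g + L)%N.
have yz : (y + y < z)%N by rewrite /z; lia.
have fg : (g < f)%N by rewrite /f; nia.
have fg' : (f + g < g')%N by rewrite /g' /f; nia.
pose al' := al + 2 ^- g'; pose be' := be + 2 ^- f.
have al'E : al' = (P * 2 ^+ (g' - g) + 1)%:~R / 2 ^+ g'.
  have e : 2 ^+ g' = 2 ^+ g * 2 ^+ (g' - g) :> R by apply: exp2_split; lia.
  rewrite /al' /al intrD intrM exp2_intr e.
  by have := exp2_neq0 R g; have := exp2_neq0 R (g' - g) => ? ?; field; apply/andP.
have be'E : be' = (Q * 2 ^+ (f - g) + 1)%:~R / 2 ^+ f.
  have e : 2 ^+ f = 2 ^+ g * 2 ^+ (f - g) :> R by apply: exp2_split; lia.
  rewrite /be' /be intrD intrM exp2_intr e.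
  by have := exp2_neq0 R g; have := exp2_neq0 R (f - g) => ? ?; field; apply/andP.
have oQ : odd (absz (Q * 2 ^+ (f - g) + 1)%R) by apply: odd_mul_exp2D => //; lia.
have be'E' : be' = ((Q * 2 ^+ (f - g) + 1) * 2 ^+ (g' - f))%:~R / 2 ^+ g'.
  have e : 2 ^+ g' = 2 ^+ f * 2 ^+ (g' - f) :> R by apply: exp2_split; lia.
  rewrite be'E intrM exp2_intr e.
  by have := exp2_neq0 R f; have := exp2_neq0 R (g' - f) => ? ?; field; apply/andP.
exists (diag2 al' be'), g'; split.
- by rewrite /g'; nia.
- exists (P * 2 ^+ (g' - g) + 1), ((Q * 2 ^+ (f - g) + 1) * 2 ^+ (g' - f)), g'.
  split; [by apply: odd_mul_exp2D => //; lia | by rewrite leq_pmull |].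
  by rewrite -al'E -be'E'.
- have small x : (z <= x)%N -> `|2 ^- x : R| <= rho.
    move=> zx; rewrite ger0_norm ?invr_ge0 ?exprn_ge0 //; apply: HN.
    by apply: leq_trans zx; rewrite /z; lia.
  apply/mx_norm_leP; first exact: ltW.
  move=> i j; rewrite !mxE.
  case: ifP => _; case: ifP => _; rewrite ?subrr ?normr0 ?(ltW rho0) //.
    by rewrite addrAC subrr add0r small // /g'; nia.
  by rewrite addrAC subrr add0r small // /f; nia.
- have cov1 x : (y <= x)%N -> exists b a, [/\ (0 < height b)%N,
      (height b <= 2 ^ (m.+2 * x))%N & residue (diag2 al' be') b a <= 2 ^+ g / 2 ^+ g'].
    move=> yx; exists (pair_col (2 ^+ g) 0), (\col_i if i == ord0 then - P else 0).
    split; first by apply: height_pair_col_gt0; rewrite expf_neq0.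
      by apply: height_pair_col => //; rewrite abszX leq_exp2l //; nia.
    have r0 : 0 <= 2 ^+ g / 2 ^+ g' :> R by rewrite divr_ge0 ?exprn_ge0.
    apply: residue_diag2_le => //; rewrite ?mxE /=.
    + by move=> i n0 _; rewrite mxE (negPf n0).
    + rewrite exp2_intr /al' /al mulrDl mulrVK ?unitfE ?exp2_neq0 //.
      by rewrite mulrNz addrAC subrr add0r mulrC ger0_norm.
    + by rewrite mulr0 addr0 normr0.
split.
+ move=> x /andP[yx xh']; have [xz|zx] := ltnP x z.
  * have [b [a [b0 bx ba]]] := cov1 x yx; exists b, a; split => //.
    apply: le_trans (ler_wpM2r _ ba) _; first by rewrite exprn_ge0.
    by apply: exp2_quot_le; rewrite /g'; nia.
  * exists (pair_col 0 (2 ^+ f)),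
      (\col_i if i == i1 then - (Q * 2 ^+ (f - g) + 1) else 0).
    split; first by apply: height_pair_col_gt0; rewrite expf_neq0 ?orbT.
      by apply: height_pair_col => //; rewrite abszX leq_exp2l // leq_mul2l zx orbT.
    apply: (@le_trans _ _ 0); last by rewrite invr_ge0 exprn_ge0.
    rewrite pmulr_lle0 ?exprn_gt0 //; apply: residue_diag2_le; rewrite ?mxE //=.
    - by move=> i _ n1; rewrite mxE (negPf n1).
    - by rewrite mulr0 addr0 normr0.
    - rewrite be'E exp2_intr mulrNz mulrVK ?unitfE ?exp2_neq0 //.
      by rewrite subrr normr0.
+ exists y; first by rewrite leqnn /= /g'; nia.
  have [b [a [b0 bx ba]]] := cov1 y (leqnn y); exists b, a; split => //.
  apply: le_trans (ler_wpM2r _ ba) _; first by rewrite exprn_ge0.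
  by apply: exp2_quot_le; rewrite /g'; nia.
+ exists z.-1; first by apply/andP; split; rewrite ?/g'; nia.
  move=> b a b0 bx.
  apply: (@le_trans _ _ (2 ^+ g / 2 ^+ g' * 2 ^+ (n * z.-1))).
    by apply: exp2_quot_ge; rewrite /g'; nia.
  apply: ler_wpM2r; first by rewrite exprn_ge0.
  have bf i : `|b i ord0| < 2 ^+ f.
    apply: le_lt_trans (height_le_coord i bx) _.
    by rewrite -natz natrX ltr_eXn2l // /f; nia.
  (* A nonzero second entry already gives at least [2 ^- f] in row 1, which is more than
     [2 ^ g / 2 ^ g']. *)
  have [b20|b2n] := eqVneq (b (lift ord0 ord0) ord0) 0; last first.
    apply: le_trans (residue_entry _ _ _ i1); rewrite diag2_sum1 be'E.
    set b2 := b _ ord0 in b2n *; set a1 := a i1 ord0.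
    pose X := b2 * (Q * 2 ^+ (f - g) + 1) + a1 * 2 ^+ f.
    rewrite (_ : _ + _ = X%:~R / 2 ^+ f); last first.
      rewrite /X !(intrD, intrM) !exp2_intr.
      by have := exp2_neq0 R f => ?; field.
    rewrite normrM normfV (ger0_norm (exprn_ge0 f _)) //.
    have X0 : X != 0.
      apply: contraNneq b2n => X0; apply/eqP/(dvdz_small _ (bf _)).
      apply: odd_dvd_exp2 oQ _; apply/dvdzP; exists (- a1).
      by move/eqP: X0; rewrite addr_eq0 mulNr => /eqP.
    apply: (@le_trans _ _ (1 / 2 ^+ f)).
      rewrite ler_pdivrMr ?exprn_gt0 // mulrAC ler_pdivlMr ?exprn_gt0 //.
      by rewrite mul1r -exprD ler_weXn2l ?ler1n //; lia.
    rewrite ler_wpM2r ?invr_ge0 ?exprn_ge0 //.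
    by apply: (@ler_intr_norm R 1 X); rewrite -gtz0_ge1 normr_gt0.
  have b1n : b ord0 ord0 != 0.
    by apply: contra_eq_neq b20 => b10; apply: height2_neq0.
  apply: le_trans (residue_entry _ _ _ ord0); rewrite diag2_sum0 al'E.
  set b1 := b _ ord0 in b1n *; set a0 := a ord0 ord0.
  pose K := b1 * P + a0 * 2 ^+ g; pose X := K * 2 ^+ (g' - g) + b1.
  rewrite (_ : _ + _ = X%:~R / 2 ^+ g'); last first.
    have e : 2 ^+ g' = 2 ^+ g * 2 ^+ (g' - g) :> R by apply: exp2_split; lia.
    rewrite /X /K !(intrD, intrM) !exp2_intr e.
    have := exp2_neq0 R g; have := exp2_neq0 R (g' - g) => ? ?.
    by field; apply/andP.
  rewrite normrM normfV (ger0_norm (exprn_ge0 g' _)) //.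
  rewrite ler_wpM2r ?invr_ge0 ?exprn_ge0 // -exp2_intr.
  (* If [K = 0], then [2 ^ g] divides [b1]; otherwise the multiple of [2 ^ (g' - g)], at least
     [2 ^ (f + 1)], outweighs [|b1| < 2 ^ f]. *)
  apply: ler_intr_norm; have [K0|K0] := eqVneq K 0.
    rewrite /X K0 mul0r add0r leNgt; apply/negP => b1g.
    move/eqP: b1n; apply; apply: dvdz_small b1g; apply: odd_dvd_exp2 oP _.
    apply/dvdzP; exists (- a0).
    by move/eqP: K0; rewrite addr_eq0 mulNr => /eqP.
  have -> : X = K * 2 ^+ (g' - g) - - b1 by rewrite opprK.
  apply: le_trans (lerB_dist _ _); rewrite normrN lerBrDr.
  apply: (@le_trans _ _ (2 ^+ (g' - g))).
    apply: (@le_trans _ _ (2 ^+ f + 2 ^+ f)).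
      by apply: lerD; [apply: ler_weXn2l => //; lia|exact/ltW/bf].
    have -> : 2 ^+ f + 2 ^+ f = 2 ^+ f.+1 :> int by rewrite exprS; ring.
    by apply: ler_weXn2l => //; lia.
  by rewrite normrM [leRHS]mulrC normrX ler_peMr ?exprn_ge0 // -gtz0_ge1 normr_gt0.
Qed.

Lemma exists_special_diag n L : (m.+2 <= n)%N -> (1 <= L)%N ->
  exists A : 'M[R]_(m.+2, 2), special n (2 * 2 ^- L) A.
Proof.
move=> mn L1.
have I0 : dyadic_diag (diag2 1 0) 0.
  by exists 1, 0, 0%N; split => //; rewrite expr0 !divr1.
have [|||A _ spA] := @exists_special R m.+2 n 2 (2 ^- L) (2 ^- (n + L)) _ _ _ _ _ I0.
- by rewrite invr_gt0 exprn_gt0.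
- by rewrite invr_gt0 exprn_gt0.
- by move=> A y rho; exact: step_diag.
- by exists A.
Qed.

End diagonal.

(** * Single columns, for more rows than columns *)

Section columns.

(* Coordinate 0 is close to P 0 / 2 ^ g with P 0 odd, so b must be divisible
   by 2 ^ g; the remaining coordinates then force one more block of binary
   digits of b to vanish each. *)
Lemma dvd_exp2_of_small_residues m (P a : nat -> int) (h : nat -> nat) g H (b : int) :
  odd `|P 0%N| -> h 0%N = (g + H)%N -> (H + g + g <= h 1%N <= H + H)%N ->
  (forall i, (i <= m)%N -> (h i <= h i.+1 <= h i + H)%N) ->
  (forall i, (i <= m.+1)%N ->
    `|b + 2 ^+ (h i - g) * (b * P i + a i * 2 ^+ g)| * 2 ^+ H.+1 < 2 ^+ h i) ->
  (2 ^+ h m.+1 %| b)%Z.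
Proof.
move=> oP h0 /andP[h1l h1u] hinc small.
(* [s i] is the numerator over [2 ^ h i] of the residue in coordinate [i], for the entry
   [P i / 2 ^ g + 2 ^- h i]. *)
pose K i := b * P i + a i * 2 ^+ g; pose s i := b + 2 ^+ (h i - g) * K i.
have e2 (k : nat) : 0 < 2 ^+ k :> int by rewrite exprn_gt0.
have s0 : `|s 0%N| * 2 < 2 ^+ g.
  have := small 0%N isT; rewrite -/(K _) -/(s _) h0 exprD exprS mulrA.
  by rewrite ltr_pM2r.
have s1 : `|s 1%N| * 2 < 2 ^+ H.
  have := small 1%N isT; rewrite -/(K _) -/(s _) exprS mulrA => /lt_le_trans.
  move=> /(_ (2 ^+ (H + H))); rewrite exprD ltr_pM2r //; apply.
  by rewrite -exprD ler_weXn2l.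
have gH : 2 ^+ g <= 2 ^+ H :> int by apply: ler_weXn2l => //; lia.
(* Both are congruent to [b] modulo [2 ^ H] and less than half of [2 ^ H] in absolute value. Their
   equality makes [2 ^ g] divide [K 0], as [h 1 >= H + 2 g]. *)
have s01 : s 0%N = s 1%N.
  apply/eqP; rewrite -subr_eq0; apply/eqP; apply: (@dvdz_small (2 ^+ H)).
    have -> : s 0%N - s 1%N = (K 0%N - 2 ^+ (h 1%N - g - H) * K 1%N) * 2 ^+ H.
      rewrite /s h0 addKn.
      have -> : (h 1%N - g = h 1%N - g - H + H)%N by lia.
      by rewrite exprD addnK; ring.
    exact: dvdz_mull.
  by apply: le_lt_trans (ler_normB _ _) _; lia.
have K0 : K 0%N = 2 ^+ (h 1%N - g - H) * K 1%N.
  apply: (@mulfI _ (2 ^+ H)); first by rewrite expf_neq0.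
  move: s01; rewrite /s h0 addKn => /addrI ->.
  by rewrite mulrA -exprD; congr (_ ^+ _ * _); lia.
have bg : (2 ^+ g %| b)%Z.
  apply: odd_dvd_exp2 oP _; rewrite -(rpredDr _ (_ : a 0%N * 2 ^+ g \in dvdz (2 ^+ g))).
    change ((2 ^+ g %| K 0%N)%Z); rewrite K0; apply/dvdz_mulr/dvdz_exp2l; lia.
  exact: dvdz_mull.
have Kg i : (2 ^+ g %| K i)%Z.
  by apply: rpredD; [exact: dvdz_mulr|exact: dvdz_mull].
have hgt i : (i <= m.+1)%N -> (g <= h i)%N.
  elim: i => [|i IH] im; first by rewrite h0 leq_addr.
  by have := hinc i im; have := IH (ltnW im); lia.
have Kh i : (i <= m.+1)%N -> (2 ^+ h i %| 2 ^+ (h i - g) * K i)%Z.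
  move=> im; rewrite -[in X in (X %| _)%Z](subnK (hgt i im)) exprD.
  exact: dvdz_mul.
have b_dvd i : (i <= m.+1)%N -> s i = 0 -> (2 ^+ h i %| b)%Z.
  move=> im si; have -> : b = - (2 ^+ (h i - g) * K i).
    by apply/eqP; rewrite -addr_eq0; apply/eqP.
  by rewrite rpredN; exact: Kh.
have bh i : (i <= m.+1)%N -> (2 ^+ h i %| b)%Z.
  elim: i => [|i IH] im.
    apply: b_dvd => //; apply: (@dvdz_small (2 ^+ g)).
      by apply: rpredD => //; exact: dvdz_mull.
    by have := normr_ge0 (s 0%N); lia.
  (* Divisibility of [b] by [2 ^ h i] passes to [s i.+1], which is smaller than [2 ^ h i] because
     [h] grows by at most [H]; so it vanishes. *)
  have /andP[hi1 hi2] := hinc i im; apply: b_dvd => //.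
  apply: (@dvdz_small (2 ^+ h i)).
    apply: rpredD; first exact: IH (ltnW im).
    by apply: dvdz_trans (Kh _ im); exact: dvdz_exp2l.
  have := small _ im; rewrite -/(K _) -/(s _) exprS mulrA => /lt_le_trans.
  move=> /(_ (2 ^+ (h i + H))); rewrite exprD ltr_pM2r //.
  have -> : 2 ^+ h i.+1 <= 2 ^+ h i * 2 ^+ H :> int.
    by rewrite -exprD ler_weXn2l.
  by move=> /(_ isT); have := normr_ge0 (s i.+1); lia.
exact: bh.
Qed.

Variables (R : realType) (m : nat).

Definition dyadic_col (A : 'M[R]_(m.+2, 1)) (y : nat) :=
  exists P : nat -> int, odd `|P 0%N| /\
    A = \col_i ((P i)%:~R / 2 ^+ (m.+2 * y)).

(* The denominator 2 ^ g serves for all scales up to 2 ^ t; the digits at the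
   positions h i make the new rational point badly approximable below 2 ^ t, and
   the last digit of coordinate 0, at g', restores the parity of P 0. *)
Lemma step_col n L A y rho : (1 <= n)%N -> (n < m.+2)%N -> dyadic_col A y ->
  0 < rho -> exists A' y', [/\ (y < y')%N, dyadic_col A' y',
     `|A' - A| <= rho &
     stage n (2 ^- L) (2 ^- y) (2 ^- (n + L + 3)) y y' A'].
Proof.
move=> n1 nm [P [oP ->]] rho0; set g := (m.+2 * y)%N.
have [N HN] : exists N, forall x, (N <= x)%N -> 2 ^- x <= rho / 2 :> R.
  by apply: exp2N_arbitrarily_small; rewrite divr_gt0.
(* [2 ^ g] serves below scale [z] with residue at most [2 ^ (1 - H)], which explains [H]. From [z]
   on, [2 ^ t] serves with residue at most [2 ^ t / 2 ^ g']; this lasts up to [y'] because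
   [n < m.+2] gives [g' - n y' >= y' >= t + L]. *)
pose z := (N + (2 * g + L + 2 * y).+2)%N; pose t := (m.+2 * z)%N.
pose H := (n * z + L + 1)%N.
(* The positions grow by at most [H] and reach [t] at the last coordinate, since [z <= H]. *)
pose h i := if i is 0%N then (g + H)%N else minn t (i.+1 * H).
pose y' := (t + H + L + 2)%N; pose g' := (m.+2 * y')%N.
have zH : (z <= H)%N by rewrite /H; nia.
have Ht : (H + g + g <= t)%N by rewrite /H /t /z; nia.
have gH : (g + g <= H)%N by apply: leq_trans zH; rewrite /z; lia.
have yz : (y + y + 2 <= z)%N by rewrite /z; lia.
have zt : (z <= t)%N by rewrite /t leq_pmull.
have nzE : (n * z = n * z.-1 + n)%N by rewrite -mulnSr prednK //; lia.
have nyz : (n * y + n * y <= n * z)%N by rewrite -mulnDr leq_mul2l; lia.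
have yny : (y <= n * y)%N by rewrite leq_pmull.
have hinc i : (h i <= h i.+1 <= h i + H)%N.
  case: i => [|i]; rewrite /h /=; first by lia.
  by rewrite mulSn; lia.
have hge i : (g + H <= h i)%N.
  elim: i => [|i IH] //; apply: leq_trans IH _.
  by case/andP: (hinc i).
have hle i : (h i <= t)%N by case: i => [|i]; rewrite /h; lia.
have hm : h m.+1 = t.
  rewrite /h; apply/minn_idPl; rewrite /t leq_mul2l /=.
  exact: zH.
have tg' : (t + H + 2 <= g')%N.
  by apply: (@leq_trans y'); rewrite ?leq_pmull // /y'; lia.
pose P' (i : nat) := P i * 2 ^+ (g' - g) + 2 ^+ (g' - h i) + (i == 0%N)%:R.
pose A' : 'M[R]_(m.+2, 1) :=
  \col_i ((P i)%:~R / 2 ^+ g + 2 ^- h i + (i == ord0)%:R / 2 ^+ g').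
have split_exp i : 2 ^+ g' = 2 ^+ h i * 2 ^+ (g' - h i) :> R.
  by apply: exp2_split; have := hle i; lia.
have A'E i j : A' i j = (P' i)%:~R / 2 ^+ g'.
  have e := exp2_split R (_ : (g <= g')%N); rewrite mxE /P' !intrD intrM !exp2_intr.
  have -> : ((i == 0 :> nat)%:R : int)%:~R = (i == ord0)%:R :> R.
    by rewrite -[i == ord0]/(i == 0 :> nat); case: (i == 0 :> nat).
  rewrite !mulrDl; congr (_ + _ + _).
    rewrite e; last by lia.
    by have := exp2_neq0 R g; have := exp2_neq0 R (g' - g) => ? ?; field; apply/andP.
  rewrite (split_exp i).
  have := exp2_neq0 R (h i); have := exp2_neq0 R (g' - h i) => ? ?.
  by field; apply/andP.
have eps_le (i : 'I_m.+2) d : (g + d <= h i)%N -> (g + d <= g')%N ->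
    0 <= (2 ^- h i + (i == ord0)%:R / 2 ^+ g' : R) <= 2 / 2 ^+ (g + d).
  move=> hd gd; have e1 := exp2N_le R hd; have e2 := exp2N_le R gd.
  have p1 : 0 <= 2 ^- h i :> R by rewrite invr_ge0 exprn_ge0.
  have p2 : 0 <= 2 ^- g' :> R by rewrite invr_ge0 exprn_ge0.
  by case: (i == ord0) => /=; rewrite ?mul0r ?mul1r; apply/andP; split; lra.
exists A', y'; split.
- by rewrite /y'; lia.
- exists P'; split; last by apply/matrixP => i j; rewrite A'E !mxE.
  have -> : P' 0%N = (P 0%N * 2 ^+ (h 0%N - g) + 1) * 2 ^+ (g' - h 0%N) + 1.
    rewrite /P' /= mulrDl mul1r -mulrA -exprD; congr (_ * _ ^+ _ + _ + _).
    by have := hle 0%N; have := hge 0%N; lia.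
  by apply: odd_mul_exp2D => //; have := hle 0%N; lia.
- apply/mx_norm_leP; first exact: ltW.
  move=> i j; rewrite !mxE -!addrA addrC addrA subrK.
  have zg : (g + (z - g) = z)%N by rewrite /z; lia.
  have /andP[e1 e2] := @eps_le i (z - g)%N ltac:(rewrite zg; have := hge i; lia)
    ltac:(rewrite zg; lia).
  rewrite ger0_norm //; apply: le_trans e2 _; rewrite zg.
  have : 2 ^- z <= rho / 2 :> R by apply: HN; rewrite /z; lia.
  lra.
- have cov1 x : (y <= x)%N -> exists b a, [/\ (0 < height b)%N,
      (height b <= 2 ^ (m.+2 * x))%N & residue A' b a <= 2 ^+ 1 / 2 ^+ H].
    move=> yx; exists (const_mx (2 ^+ g)), (\col_i - P i); split.
    + rewrite height_gt0; apply/eqP => /matrixP/(_ ord0 ord0); rewrite !mxE => /eqP.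
      by rewrite expf_eq0 /= andbF.
    + by apply/height_leP => i; rewrite mxE abszX leq_exp2l // leq_mul2l yx orbT.
    apply/residue_leP; first by rewrite divr_ge0 ?exprn_ge0.
    move=> i; rewrite big_ord1 !mxE exp2_intr mulrNz.
    have -> : ((P i)%:~R / 2 ^+ g + 2 ^- h i + (i == ord0)%:R / 2 ^+ g') * 2 ^+ g -
        (P i)%:~R = (2 ^- h i + (i == ord0)%:R / 2 ^+ g') * 2 ^+ g :> R.
      have := exp2_neq0 R g; have := exp2_neq0 R (h i); have := exp2_neq0 R g'.
      by move=> ? ? ?; field; apply/and3P.
    have /andP[e1 e2] := @eps_le i H (hge i) ltac:(lia).
    rewrite ger0_norm ?mulr_ge0 ?exprn_ge0 // -ler_pdivlMr ?exprn_gt0 //.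
    by apply: le_trans e2 _; rewrite expr1 addnC exprD invfM mulrA.
split.
+ move=> x /andP[yx xy']; have [xz|zx] := ltnP x z.
  * have [b [a [b0 bx ba]]] := cov1 x yx; exists b, a; split => //.
    apply: le_trans (ler_wpM2r _ ba) _; first by rewrite exprn_ge0.
    have : (n * x.+1 <= n * z)%N by rewrite leq_mul2l xz orbT.
    by move=> ?; apply: exp2_quot_le; rewrite /H; lia.
  * exists (const_mx (2 ^+ t)), (\col_i - (P i * 2 ^+ (t - g) + 2 ^+ (t - h i))); split.
    - rewrite height_gt0; apply/eqP => /matrixP/(_ ord0 ord0); rewrite !mxE => /eqP.
      by rewrite expf_eq0 /= andbF.
    - by apply/height_leP => i; rewrite mxE abszX leq_exp2l // leq_mul2l zx orbT.
    apply: (@le_trans _ _ (2 ^+ t / 2 ^+ g' * 2 ^+ (n * x.+1))); last first.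
      apply: exp2_quot_le; rewrite /g'.
      have : (n * x.+1 <= n * y')%N by rewrite leq_mul2l xy' orbT.
      have : (n * y' + y' <= m.+2 * y')%N by rewrite -mulSnr leq_mul2r nm orbT.
      by rewrite /y'; lia.
    apply: ler_wpM2r; first by rewrite exprn_ge0.
    apply/residue_leP; first by rewrite divr_ge0 ?exprn_ge0.
    move=> i; rewrite big_ord1 !mxE exp2_intr mulrNz intrD intrM !exp2_intr.
    have -> : ((P i)%:~R / 2 ^+ g + 2 ^- h i + (i == ord0)%:R / 2 ^+ g') * 2 ^+ t -
        ((P i)%:~R * 2 ^+ (t - g) + 2 ^+ (t - h i)) =
        (i == ord0)%:R * (2 ^+ t / 2 ^+ g') :> R.
      rewrite !mulrDl.
      rewrite {1}(exp2_split R (_ : (g <= t)%N)); last by lia.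
      rewrite {1}(exp2_split R (hle i)).
      have := exp2_neq0 R g; have := exp2_neq0 R (h i); have := exp2_neq0 R g'.
      by move=> ? ? ?; field; apply/and3P.
    rewrite ger0_norm; last by rewrite mulr_ge0 ?divr_ge0 ?exprn_ge0.
    by rewrite ler_piMl ?divr_ge0 ?exprn_ge0 //; case: eqP.
+ exists y; first by rewrite leqnn /= /y'; lia.
  have [b [a [b0 bx ba]]] := cov1 y (leqnn y); exists b, a; split => //.
  apply: le_trans (ler_wpM2r _ ba) _; first by rewrite exprn_ge0.
  by apply: exp2_quot_le; rewrite /H; lia.
(* Every nonzero [b] below [2 ^ t] has residue at least [2 ^- (H + 2)]; with [H = n z + L + 1] this
   is the constant claimed at scale [z - 1]. *)
+ exists z.-1; first by apply/andP; split; rewrite /y'; lia.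
  move=> b a b0 bx.
  apply: (@le_trans _ _ (2 ^+ 0 / 2 ^+ (H + 2) * 2 ^+ (n * z.-1))).
    by apply: exp2_quot_ge; rewrite /H; lia.
  apply: ler_wpM2r; first by rewrite exprn_ge0.
  rewrite expr0 mul1r leNgt; apply/negP => small.
  set b1 := b ord0 ord0.
  have bt : `|b1| < 2 ^+ t.
    apply: le_lt_trans (height_le_coord ord0 bx) _.
    by rewrite -natz natrX ltr_eXn2l // /t ltn_pmul2l //; lia.
  have : b1 != 0.
    move: b0; rewrite height_gt0; apply: contraNneq => b10.
    by apply/eqP/matrixP => i j; rewrite !ord1 mxE.
  move/eqP; apply; apply: (dvdz_small _ bt); rewrite -hm.
  apply: (@dvd_exp2_of_small_residues m P (fun i => a (inord i) ord0) h g H) => //.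
    by have := hinc 0%N; rewrite /h; lia.
  move=> i im; set ai := a _ _; set s := _ + _.
  have iE : (inord i : 'I_m.+2) = i :> nat by rewrite inordK.
  have := residue_entry A' b a (inord i); rewrite big_ord1 mxE iE -/ai -/b1 => ri.
  have sE : s%:~R / 2 ^+ h i = ((P i)%:~R / 2 ^+ g + 2 ^- h i) * b1%:~R + ai%:~R :> R.
    have e : 2 ^+ h i = 2 ^+ g * 2 ^+ (h i - g) :> R.
      by apply: exp2_split; have := hge i; lia.
    rewrite /s !(intrD, intrM) !exp2_intr e.
    have := exp2_neq0 R g; have := exp2_neq0 R (h i - g) => ? ?.
    by field; apply/andP.
  have : `|s%:~R / 2 ^+ h i| < 2 ^- H.+1 :> R.
    (* The digit at [g'], present in coordinate 0 only; removing it costs at most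
       [2 ^ t / 2 ^ g' <= 2 ^- (H + 2)]. *)
    pose q : R := (inord i == ord0 :> 'I_m.+2)%:R / 2 ^+ g'.
    have qb : `|q * b1%:~R| <= 2 ^- (H + 2).
      have qg : `|q| <= 2 ^- g'.
        rewrite /q ger0_norm ?divr_ge0 ?exprn_ge0 //.
        by rewrite ler_piMl ?invr_ge0 ?exprn_ge0 //; case: eqP.
      have bR : `|b1%:~R| <= 2 ^+ t :> R.
        by rewrite -intr_norm -exp2_intr ler_int ltW.
      rewrite normrM; apply: le_trans (ler_pM _ _ qg bR) _ => //.
      rewrite mulrC ler_pdivrMr ?exprn_gt0 // mulrC ler_pdivlMr ?exprn_gt0 //.
      by rewrite -exprD ler_weXn2l ?ler1n // addnA.
    have -> : s%:~R / 2 ^+ h i =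
        (((P i)%:~R / 2 ^+ g + 2 ^- h i + q) * b1%:~R + ai%:~R) - q * b1%:~R.
      by rewrite sE; ring.
    apply: le_lt_trans (ler_normB _ _) _.
    have -> : 2 ^- H.+1 = 2 ^- (H + 2) + 2 ^- (H + 2) :> R.
      by rewrite addn2 [2 ^+ H.+2]exprS invfM; field; exact: exp2_neq0.
    apply: ltr_leD qb; exact: le_lt_trans ri small.
  rewrite normrM normfV (ger0_norm (exprn_ge0 (h i) _)) //.
  rewrite ltr_pdivrMr ?exprn_gt0 // mulrC ltr_pdivlMr ?exprn_gt0 //.
  by rewrite -!exp2_intr -intr_norm -intrM ltr_int.
Qed.

Lemma exists_special_col n L : (1 <= n)%N -> (n < m.+2)%N ->
  exists A : 'M[R]_(m.+2, 1), special n (2 * 2 ^- L) A.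
Proof.
move=> n1 nm.
have I0 : dyadic_col (\col_i ((i == 0 :> nat)%:R : int)%:~R) 0.
  exists (fun i => (i == 0%N)%:R); split => //.
  by apply/matrixP => i j; rewrite !mxE muln0 expr0 divr1.
have [|||A _ spA] := @exists_special R m.+2 n 1 (2 ^- L) (2 ^- (n + L + 3)) _ _ _ _ _ I0.
- by rewrite invr_gt0 exprn_gt0.
- by rewrite invr_gt0 exprn_gt0.
- by move=> A y rho; exact: step_col.
- by exists A.
Qed.

End columns.

(** * Hausdorff dimension of limsup sets of boxes *)

Section finite_counting.
Variable R : realType.

Lemma card_bounded_diff (q : nat) (S : {set 'I_q}) (D : R) : 0 <= D ->
  (forall x y, x \in S -> y \in S -> (x : nat)%:R - (y : nat)%:R <= D) ->
  #|S|%:R <= D + 1.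
Proof.
move=> D0 H; have [->|/set0Pn[x0 x0S]] := eqVneq S finset.set0.
  by rewrite cards0; lra.
pose y := [arg min_(i < x0 in S) (i : nat)].
have [yS ymin] : y \in S /\ forall x, x \in S -> (y <= x)%N.
  by rewrite /y; case: arg_minnP.
pose K := Num.trunc D.
have xK x : x \in S -> (x - y < K.+1)%N.
  move=> xS; have := H x y xS yS; rewrite -natrB ?ymin // => xyD.
  have DK : D < K.+1%:R by have := truncn_le_nat D K; rewrite leqnn => <-.
  by rewrite -(ltr_nat R) (le_lt_trans xyD).
have inj : {in S &, injective (fun x : 'I_q => inord (x - y) : 'I_K.+1)}.
  move=> x x' xS x'S /(congr1 (@nat_of_ord _)).
  rewrite !inordK ?xK // => e; apply: val_inj => /=.
  by rewrite -(subnK (ymin _ xS)) e subnK // ymin.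
have : (#|S| <= K.+1)%N.
  by rewrite -(card_in_imset inj) -[X in (_ <= X)%N]card_ord max_card.
rewrite -(ler_nat R) => /le_trans; apply; rewrite -natr1 lerD2r.
by rewrite truncn_le.
Qed.

Lemma card_family_le (J : finType) q (F : J -> pred 'I_q) (M : R) : 0 <= M ->
  (forall j, #|F j|%:R <= M) -> #|(family F : pred {ffun J -> 'I_q})|%:R <= M ^+ #|J|.
Proof.
move=> M0 H; rewrite card_family foldrE big_image /= natr_prod.
rewrite -prodr_const; apply: ler_prod => j _; rewrite ler0n; exact: H.
Qed.

End finite_counting.

Section boxes.
Variables (R : realType) (J : finType).
Implicit Types (x X : J -> R) (l s d : R) (U W : set (J -> R)).

Definition box x l : set (J -> R) := [set X | forall j, x j <= X j <= x j + l].

Definition grid x l (q : nat) (p : {ffun J -> 'I_q}) : J -> R :=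
  fun j => x j + l / q%:R * (p j : nat)%:R.

Definition meets x l U : bool := `[< exists X, U X /\ box x l X >].

Lemma grid_sub x l q (p : {ffun J -> 'I_q}) : 0 <= l -> (0 < q)%N ->
  forall j, x j <= grid x l p j /\ grid x l p j + l / q%:R <= x j + l.
Proof.
move=> l0 q0 j; rewrite /grid; have q0R : 0 < q%:R :> R by rewrite ltr0n.
have lq : 0 <= l / q%:R by rewrite divr_ge0.
split; first by rewrite lerDl mulr_ge0.
rewrite -addrA lerD2l -{2}[l / q%:R]mulr1 -mulrDr natr1.
by rewrite -[leRHS](divfK (lt0r_neq0 q0R)) ler_wpM2l // ler_nat.
Qed.

Lemma box_grid_sub x l q (p : {ffun J -> 'I_q}) X : 0 <= l -> (0 < q)%N ->
  box (grid x l p) (l / q%:R) X -> box x l X.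
Proof.
move=> l0 q0 H j; have [h1 h2] := grid_sub x p l0 q0 j; have /andP[h3 h4] := H j.
by apply/andP; split; lra.
Qed.

(** In each coordinate the indices of two subcubes met by [U] differ by at most [d / lam + 1], the
    side of a subcube being [lam]; the coordinates multiply. *)
Lemma card_meets x (lam l d : R) q U : (0 < q)%N -> l = lam * q%:R -> 0 < lam -> 0 <= d ->
  (forall X Y, U X -> U Y -> forall j, `|X j - Y j| <= d) ->
  #|[set p : {ffun J -> 'I_q} | meets (grid x l p) lam U]%SET|%:R <= (d / lam + 2) ^+ #|J|.
Proof.
move=> q0 -> lam0 d0 H; have qn : q%:R != 0 :> R by rewrite pnatr_eq0 -lt0n.
set M := (X in #|X|%:R <= _).
pose S j : {set 'I_q} := [set p j | p : {ffun J -> 'I_q} in M]%SET.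
have D0 : 0 <= d / lam + 2 by rewrite addr_ge0 // divr_ge0 // ltW.
apply: (@le_trans _ _ #|(family (fun j => mem (S j)) : pred {ffun J -> 'I_q})|%:R).
  rewrite ler_nat; apply/subset_leq_card/fintype.subsetP => p pM.
  by apply/familyP => j; exact: imset_f.
apply: card_family_le => // j.
have -> : d / lam + 2 = (d / lam + 1) + 1 by rewrite -addrA.
apply: card_bounded_diff; first by rewrite addr_ge0 // divr_ge0 // ltW.
move=> _ _ /imsetP[p pM ->] /imsetP[p' p'M ->].
move: pM; rewrite inE => /asboolP[X [UX bX]].
move: p'M; rewrite inE => /asboolP[Y [UY bY]].
have /andP[_ h1] := bY j; have /andP[h2 _] := bX j.
have := H _ _ UX UY j; rewrite ler_norml => /andP[h3 h4].
move: h1 h2; rewrite /grid mulfK // => h1 h2.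
have -> : d / lam + 1 = (d + lam) / lam by rewrite mulrDl divff // lt0r_neq0.
by rewrite ler_pdivlMr // mulrBl; lra.
Qed.

End boxes.

(** * Points of a limsup set outside a given cover *)

Section avoid.
Variables (R : realType) (J : finType) (s theta : R) (d : nat -> R)
  (U : nat -> set (J -> R)).
Let N := #|J|.
Let C : R := 3 ^+ N.
Hypotheses (s_gt0 : 0 < s) (s_lt : s < N%:R).
Hypotheses (theta_gt0 : 0 < theta) (theta_lt : 2 * C * theta < 1).
Hypothesis d_gt0 : forall i, 0 < d i.
Hypothesis U_diam : forall i X Y, U i X -> U i Y -> forall j, `|X j - Y j| <= d i.

(** A light cube meets no [U i] with [d i] larger than its side, so a point of arbitrarily small
    light cubes lies in none of them. Bounds on all partial sums replace the series. *)
Definition light (x : J -> R) (l : R) :=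
  forall n, \sum_(i < n | meets x l (U i)) d i `^ s <= theta * l `^ s.

Let C_ge1 : 1 <= C. Proof. by rewrite /C exprn_ege1 // ler1n. Qed.

Let theta_le1 : theta <= 1.
Proof. by have := C_ge1; have := theta_gt0; have := theta_lt; nra. Qed.

Lemma light_weight x l i : light x l -> meets x l (U i) ->
  d i `^ s <= theta * l `^ s.
Proof.
move=> H mi; apply: le_trans (H i.+1); rewrite (bigD1 ord_max) //=.
by rewrite lerDl sumr_ge0 // => j _; exact: powR_ge0.
Qed.

Lemma light_diam x l i : 0 <= l -> light x l -> meets x l (U i) -> d i <= l.
Proof.
move=> l0 H mi; rewrite leNgt; apply/negP => ld.
have := light_weight H mi; apply/negP; rewrite -ltNge.
apply: (@le_lt_trans _ _ (l `^ s)); first by rewrite ler_piMl ?powR_ge0.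
by apply: gt0_ltr_powR; rewrite ?nnegrE // ltW.
Qed.

(* Averaging over the good subcubes, each weight being truncated at the
   admissible load tau of a subcube: a set of diameter d meets about
   (d / lam + 2) ^ N subcubes of side lam. *)
Lemma exists_light_subcube x l q (G : {set {ffun J -> 'I_q}}) :
  0 < l -> (0 < q)%N -> 2 * C < q%:R `^ (N%:R - s) -> light x l ->
  (q ^ N <= 2 * #|G|)%N -> exists2 p, p \in G & light (grid x l p) (l / q%:R).
Proof.
move=> l0 q0 qC lx Gq; apply: contrapT => nex.
have q0R : 0 < q%:R :> R by rewrite ltr0n.
pose lam := l / q%:R; have lam0 : 0 < lam by rewrite divr_gt0.
have le : l = lam * q%:R by rewrite /lam divfK // lt0r_neq0.
pose tau := theta * lam `^ s; have tau0 : 0 < tau by rewrite mulr_gt0 ?powR_gt0.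
have /choice[nn nnP] : forall p, exists n, p \in G ->
    tau < \sum_(i < n | meets (grid x l p) lam (U i)) d i `^ s.
  move=> p; have [pG|] := boolP (p \in G); last by exists 0%N.
  have /existsNP[n nP] : ~ light (grid x l p) lam by move=> H; apply: nex; exists p.
  by exists n => _; rewrite ltNge; apply/negP.
pose n := \max_p nn p.
have w0 i : 0 <= Num.min (d i `^ s) tau by rewrite le_min powR_ge0 ltW.
have load p : p \in G -> tau <=
    \sum_(i < n | meets (grid x l p) lam (U i)) Num.min (d i `^ s) tau.
  move=> pG; have pn : (nn p <= n)%N by exact: (leq_bigmax p).
  have [[i /andP[mi ti]]|H] := pselect (exists i : 'I_n,
      meets (grid x l p) lam (U i) && (tau <= d i `^ s)).
    rewrite (bigD1 i) //= min_r // lerDl sumr_ge0 //.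
  apply: le_trans (ltW (nnP p pG)) _.
  rewrite (big_ord_widen_cond n (fun i => meets (grid x l p) lam (U i))
    (fun i => d i `^ s)) //.
  rewrite [leRHS](bigID (fun i : 'I_n => (i < nn p)%N)) /=.
  rewrite -[leLHS]addr0; apply: lerD; last exact: sumr_ge0.
  apply: ler_sum => i /andP[mi _]; rewrite le_min lexx /= leNgt.
  by apply/negP => /ltW ti; apply: H; exists i; rewrite mi.
have total : tau * q%:R ^+ N <= 2 * \sum_(p in G)
    \sum_(i < n | meets (grid x l p) lam (U i)) Num.min (d i `^ s) tau.
  apply: (@le_trans _ _ (2 * (tau *+ #|G|))).
    rewrite -[tau *+ _]mulr_natr mulrCA -natrM -natrX; apply: ler_wpM2l; first exact: ltW.
    by rewrite ler_nat.
  by rewrite ler_pM2l // -sumr_const; apply: ler_sum => p; exact: load.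
(* If [d i <= lam], at most [C] subcubes are met, each with weight [d i ^ s]. Otherwise at most
   [C (d i / lam) ^ N] are met, each with weight truncated at [tau], and [d i <= l] bounds
   [(d i / lam) ^ (N - s)] by [q ^ (N - s)]. *)
pose B := C * Num.max 1 (theta * q%:R `^ (N%:R - s)).
have B0 : 0 <= B by rewrite mulr_ge0 ?exprn_ge0 // le_max ler01.
have each i : meets x l (U i) -> Num.min (d i `^ s) tau *
    #|[set p : {ffun J -> 'I_q} | meets (grid x l p) lam (U i)]%SET|%:R <= B * d i `^ s.
  move=> mi; have d0 := ltW (d_gt0 i).
  have dl : 0 <= d i / lam by rewrite divr_ge0 // ltW.
  apply: le_trans (ler_wpM2l (w0 i) (card_meets x q0 le lam0 d0 (@U_diam i))) _.
  have [dlam|lamd] := lerP (d i) lam.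
    apply: (@le_trans _ _ (d i `^ s * C)).
      apply: ler_pM => //; first by rewrite exprn_ge0 // addr_ge0.
        by rewrite ge_min lexx.
      have dl1 : d i / lam <= 1 by rewrite ler_pdivrMr // mul1r.
      apply: lerXn2r; rewrite ?nnegrE ?addr_ge0 //.
      by rewrite (_ : 3 = 1 + 2 :> R) ?lerD2r // -natrD.
    rewrite mulrC ler_wpM2r ?powR_ge0 // /B ler_peMr ?exprn_ge0 //.
    by rewrite le_max lexx.
  have dlam1 : 1 <= d i / lam by rewrite ler_pdivlMr // mul1r ltW.
  apply: (@le_trans _ _ (tau * (C * (d i / lam) ^+ N))).
    apply: ler_pM => //; first by rewrite exprn_ge0 // addr_ge0.
      by rewrite ge_min lexx orbT.
    rewrite /C -exprMn; apply: lerXn2r.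
    - by rewrite nnegrE addr_ge0.
    - by rewrite nnegrE (mulr_ge0 _ dl).
    by move: dlam1; set u := d i / lam => ?; lra.
  have dlE : (d i / lam) ^+ N = (d i / lam) `^ s * (d i / lam) `^ (N%:R - s).
    rewrite -powRD; last by rewrite (lt0r_neq0 (lt_le_trans ltr01 dlam1)) implybT.
    by rewrite subrKC powR_mulrn.
  have dsE : lam `^ s * (d i / lam) `^ s = d i `^ s.
    by rewrite -powRM ?(ltW lam0) // mulrC divfK // lt0r_neq0.
  have dlq : (d i / lam) `^ (N%:R - s) <= q%:R `^ (N%:R - s).
    apply: ge0_ler_powR; rewrite ?nnegrE ?subr_ge0 ?(ltW s_lt) //.
    rewrite ler_pdivrMr // mulrC -le; exact: light_diam (ltW l0) lx mi.
  have -> : tau * (C * (d i / lam) ^+ N) =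
      C * (theta * (d i / lam) `^ (N%:R - s)) * d i `^ s.
    by rewrite dlE -dsE /tau; ring.
  rewrite ler_wpM2r ?powR_ge0 // /B ler_wpM2l ?exprn_ge0 // le_max.
  by rewrite ler_wpM2l ?orbT // ltW.
have sub (p : {ffun J -> 'I_q}) i : meets (grid x l p) lam (U i) -> meets x l (U i).
  move=> /asboolP[X [UX bX]]; apply/asboolP; exists X; split => //.
  exact: (@box_grid_sub _ _ x l q p X (ltW l0) q0 bX).
have swap : \sum_(p in G)
    \sum_(i < n | meets (grid x l p) lam (U i)) Num.min (d i `^ s) tau <=
    B * (theta * l `^ s).
  apply: le_trans (ler_wpM2l B0 (lx n)).
  rewrite (exchange_big_dep (fun i : 'I_n => meets x l (U i))) /=; last first.
    by move=> p i _; exact: sub.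
  rewrite mulr_sumr; apply: ler_sum => i mi.
  apply: le_trans (each i mi); rewrite sumr_const -[X in X <= _]mulr_natr.
  apply: ler_wpM2l => //; rewrite ler_nat; apply/subset_leq_card/fintype.subsetP => p.
  by rewrite unfold_in => /andP[_ mp]; rewrite inE.
have : tau * q%:R ^+ N <= 2 * (B * (theta * l `^ s)).
  by apply: le_trans total _; rewrite ler_pM2l.
have -> : l `^ s = lam `^ s * q%:R `^ s.
  by rewrite le powRM // ltW.
have -> : q%:R ^+ N = q%:R `^ (N%:R - s) * q%:R `^ s :> R.
  rewrite -powRD; last by rewrite (lt0r_neq0 q0R) implybT.
  by rewrite subrK powR_mulrn.
have -> : 2 * (B * (theta * (lam `^ s * q%:R `^ s))) = tau * (2 * B * q%:R `^ s).
  by rewrite /tau; ring.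
(* After cancellation [q ^ (N - s) <= 2 B] remains; the choice of [q] excludes one alternative of
   the maximum, [2 * C * theta < 1] the other. *)
rewrite ler_pM2l // ler_pM2r ?powR_gt0 //; apply/negP; rewrite -ltNge /B.
have Q0 : 0 < q%:R `^ (N%:R - s) :> R by rewrite powR_gt0.
rewrite mulrA maxr_pMr; last by rewrite mulr_ge0 ?exprn_ge0.
by rewrite gt_max mulr1 qC /= mulrA -[ltRHS]mul1r ltr_pM2r.
Qed.

Hypothesis U_weight : forall n, \sum_(i < n) d i `^ s <= theta.
Variable W : nat -> set (J -> R).
Hypothesis W_dense : forall x l k0 q0, 0 < l -> l <= 1 ->
  exists q k (G : {set {ffun J -> 'I_q}}), [/\ (q0 <= q)%N, (k0 <= k)%N,
    (q ^ N <= 2 * #|G|)%N & forall p, p \in G -> box (grid x l p) (l / q%:R) `<=` W k].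

(** Each step passes to a light subcube inside some later [W k]; [W_dense] offers half of the
    subcubes, a loss that [exists_light_subcube] tolerates. *)
Lemma exists_limsup_avoiding : exists X : J -> R,
  [/\ forall j, 0 <= X j <= 1, forall k0, exists2 k, (k0 <= k)%N & W k X &
      forall i, ~ U i X].
Proof.
have e0 : 0 < N%:R - s by rewrite subr_gt0.
have C2 : 0 <= 2 * C + 1 by have := C_ge1; lra.
have [q0 q0P] : exists q0, forall q, (q0 <= q)%N -> 2 * C < q%:R `^ (N%:R - s).
  pose u := (2 * C + 1) `^ (N%:R - s)^-1; have u0 : 0 <= u by exact: powR_ge0.
  exists (Num.bound u) => q uq; apply: (@lt_le_trans _ _ (u `^ (N%:R - s))).
    by rewrite /u -powRrM mulVf ?lt0r_neq0 // powRr1 //; lra.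
  apply: ge0_ler_powR; rewrite ?nnegrE ?(ltW e0) //.
  by apply: (le_trans (ltW (archi_boundP u0))); rewrite ler_nat.
pose T := {z : (J -> R) * R * nat | [/\ 0 < z.1.2, z.1.2 <= 1 & light z.1.1 z.1.2]}.
pose pos (z : T) := (sval z).1.1; pose len (z : T) := (sval z).1.2.
pose idx (z : T) := (sval z).2.
have TP z : [/\ 0 < len z, len z <= 1 & light (pos z) (len z)] by case: z.
have /choice[f fP] : forall z : T, exists z' : T, [/\ (idx z < idx z')%N,
    len z' <= len z / 2, box (pos z') (len z') `<=` W (idx z') &
    forall j, pos z j <= pos z' j /\ pos z' j + len z' <= pos z j + len z].
  move=> z; have [l0 l1 lx] := TP z.
  (* [q0] is what the averaging needs; the 2 makes the sides at least halve. *)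
  have [q [k [G [q2 kz Gq GW]]]] := W_dense (pos z) (idx z).+1 (maxn q0 2) l0 l1.
  have q2' : (2 <= q)%N by apply: leq_trans q2; exact: leq_maxr.
  have q_gt0 : (0 < q)%N by exact: ltnW.
  have qC : 2 * C < q%:R `^ (N%:R - s).
    by apply: q0P; apply: leq_trans q2; exact: leq_maxl.
  have [p pG lp] := exists_light_subcube l0 q_gt0 qC lx Gq.
  have lq : len z / q%:R <= len z / 2.
    by rewrite ler_wpM2l ?(ltW l0) // lef_pV2 ?posrE ?ltr0n // ler_nat.
  have zP : [/\ 0 < len z / q%:R, len z / q%:R <= 1 &
      light (grid (pos z) (len z) p) (len z / q%:R)].
    by split => //; [rewrite divr_gt0 // ltr0n | lra].
  exists (exist _ (grid (pos z) (len z) p, len z / q%:R, k) zP); split => //.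
    exact: GW.
  exact: grid_sub (ltW l0) q_gt0.
have z0P : [/\ 0 < (1 : R), (1 : R) <= 1 & light (fun=> 0) 1].
  split=> // n; rewrite powR1 mulr1; apply: le_trans (U_weight n).
  by rewrite [leRHS](bigID (fun i : 'I_n => meets (fun=> 0) 1 (U i))) /= lerDl
    sumr_ge0 // => i _; exact: powR_ge0.
pose z j := iter j f (exist _ ((fun=> 0, 1), 0%N) z0P : T).
have zS n : [/\ (idx (z n) < idx (z n.+1))%N,
    len (z n.+1) <= len (z n) / 2, box (pos (z n.+1)) (len (z n.+1)) `<=` W (idx (z n.+1)) &
    forall j, pos (z n) j <= pos (z n.+1) j /\
      pos (z n.+1) j + len (z n.+1) <= pos (z n) j + len (z n)] by exact: fP.
have [X XP] : exists X : J -> R, forall n, box (pos (z n)) (len (z n)) X.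
  have /choice[X XP] : forall j, exists x, forall n,
      `|x - (pos (z n) j + len (z n) / 2)| <= len (z n) / 2.
    move=> j; apply: nested_intervals => n.
      by have [/ltW ? _ _] := TP (z n); rewrite divr_ge0.
    have [_ _ _ /(_ j)[h1 h2]] := zS n; rewrite ler_norml; apply/andP; split; lra.
  exists X => n j; have := XP j n; rewrite ler_norml => /andP[h1 h2].
  by apply/andP; split; lra.
exists X; split.
- by move=> j; have := XP 0%N j; rewrite /pos /len /= add0r.
- have idx_ge n : (n <= idx (z n))%N.
    by elim: n => // n IH; have [h _ _ _] := zS n; exact: leq_ltn_trans h.
  move=> k0; exists (idx (z k0.+1)).
    exact: leq_trans (leqnSn _) (idx_ge _).
  by have [_ _ h _] := zS k0; apply: h; exact: XP.
- move=> i UX.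
  have len_le n : len (z n) <= 2 ^- n.
    elim: n => [|n IH]; first by rewrite expr0 invr1.
    have [_ h _ _] := zS n; apply: le_trans h _; rewrite exprS invfM [leRHS]mulrC.
    by rewrite ler_wpM2r ?invr_ge0.
  have [n Hn] := exp2N_arbitrarily_small (divr_gt0 (d_gt0 i) (ltr0Sn R 1)).
  have [/ltW l0 _ lx] := TP (z n).
  have : d i <= len (z n).
    by apply: light_diam l0 lx _; apply/asboolP; exists X; split.
  by have := d_gt0 i; have := len_le n; have := Hn n (leqnn n); lra.
Qed.

End avoid.

(** * Lower bounds for the Hausdorff dimension *)

Section hausdorff.
Variables (R : realType) (V : normedModType R).
Implicit Types (A B E U : set V) (s : R).
Local Open Scope ereal_scope.

Lemma diam_pow_ge0 s U : 0 <= diam_pow s U.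
Proof. by rewrite /diam_pow; case: ifP => // _; exact: poweR_ge0. Qed.

Lemma hausdorff_premeasure_ge0 s delta A : 0 <= hausdorff_premeasure s delta A.
Proof.
apply: le_ereal_inf_tmp => _ [U _ <-]; apply: nneseries_ge0 => i _ _.
exact: diam_pow_ge0.
Qed.

Lemma hausdorff_measure_ge0 s A : 0 <= hausdorff_measure s A.
Proof.
apply: le_ereal_sup_tmp; exists (hausdorff_premeasure s 1 A).
  by exists 1%R => //=.
exact: hausdorff_premeasure_ge0.
Qed.

Lemma le_hausdorff_measure s A B : A `<=` B ->
  hausdorff_measure s A <= hausdorff_measure s B.
Proof.
move=> AB; apply: ge_ereal_sup => _ [delta d0 <-].
apply: le_ereal_sup_tmp; exists (hausdorff_premeasure s delta B).
  by exists delta.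
apply: ereal_inf_le_tmp => _ [U [BU dU] <-]; exists U => //.
by split => //; exact: subset_trans BU.
Qed.

Lemma le_hausdorff_dim A B : A `<=` B -> hausdorff_dim A <= hausdorff_dim B.
Proof.
move=> AB; apply: ereal_inf_le_tmp => _ [s [s0 sB] <-]; exists s => //.
split => //; apply/eqP; rewrite eq_le hausdorff_measure_ge0 andbT -sB.
exact: le_hausdorff_measure.
Qed.

Lemma hausdorff_dim_ge0 A : 0 <= hausdorff_dim A.
Proof. by apply: le_ereal_inf_tmp => _ [s [s0 _] <-]; rewrite lee_fin. Qed.

Lemma hausdorff_dim_set0 : hausdorff_dim (set0 : set V) <= 0.
Proof.
apply: ereal_inf_lbound; exists 0%R => //; split => //.
apply/eqP; rewrite eq_le hausdorff_measure_ge0 andbT.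
apply: ge_ereal_sup => _ [delta d0 <-].
apply: ereal_inf_lbound; exists (fun=> set0).
  split => // i; apply: ge_ereal_sup => _ [z [[]]].
by rewrite eseries0 // => i _ _; rewrite /diam_pow eqxx.
Qed.

Lemma diam_bounds U (d : R) : U !=set0 -> diam U <= d%:E ->
  [/\ (0 <= fine (diam U) <= d)%R, diam U = (fine (diam U))%:E &
      forall x y, U x -> U y -> (`|x - y| <= fine (diam U))%R].
Proof.
move=> [x Ux] dU.
have d0 : 0 <= diam U.
  apply: le_ereal_sup_tmp; exists `|x - x|%:E; last by rewrite lee_fin.
  by exists (x, x).
have fin : diam U \is a fin_num.
  by rewrite ge0_fin_numE //; apply: le_lt_trans dU _; rewrite ltry.
split; last 2 first.
- by rewrite fineK.
- move=> y z Uy Uz; rewrite -lee_fin fineK //; apply: ereal_sup_ubound.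
  by exists (y, z).
by rewrite fine_ge0 //= -lee_fin fineK.
Qed.

Variables (J : finType) (W : nat -> set (J -> R)) (E : set V) (Phi : (J -> R) -> V).
Hypothesis W_dense : forall x l k0 q0, (0 < l)%R -> (l <= 1)%R ->
  exists q k (G : {set {ffun J -> 'I_q}}), [/\ (q0 <= q)%N, (k0 <= k)%N,
    (q ^ #|J| <= 2 * #|G|)%N & forall p, p \in G -> box (grid x l p) (l / q%:R) `<=` W k].
Hypothesis Phi_expanding : forall X Y j, (`|X j - Y j| <= `|Phi X - Phi Y|)%R.
Hypothesis Phi_E : forall X, (forall j, 0 <= X j <= 1)%R ->
  (forall k0, exists2 k, (k0 <= k)%N & W k X) -> E (Phi X).

(** Measure 0 would provide a cover of [E] of weight below [theta / 2]. As [Phi] does not decrease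
    distances, the preimages of its sets are no larger, and [exists_limsup_avoiding] yields a point
    whose image lies in [E] but in no set of the cover. *)
Lemma hausdorff_measure_gt0 s : (0 <= s)%R -> (s < #|J|%:R)%R ->
  hausdorff_measure s E <> 0.
Proof.
move=> s0 sN H0.
have N0 : (0 < #|J|%:R :> R)%R by exact: le_lt_trans sN.
(* The avoidance argument needs a positive exponent. Raising [s] to [s'] does not increase the
   weights, since the diameters are at most 1. *)
pose s' := Num.max s (#|J|%:R / 2)%R.
have s'0 : (0 < s')%R by rewrite lt_max divr_gt0 ?orbT.
have s'N : (s' < #|J|%:R)%R by rewrite gt_max sN /=; lra.
have ss' : (s <= s')%R by rewrite le_max lexx.
pose theta : R := (4 * 3 ^+ #|J|)^-1%R.
have theta0 : (0 < theta)%R by rewrite invr_gt0 mulr_gt0 // exprn_gt0.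
have theta1 : (2 * 3 ^+ #|J| * theta < 1)%R.
  have e : (3 ^+ #|J| != 0 :> R)%R by rewrite expf_neq0.
  have -> : (2 * 3 ^+ #|J| * theta = 2^-1)%R by rewrite /theta; field.
  lra.
have [U [EU dU] sumU] : exists2 U : nat -> set V, E `<=` \bigcup_i U i /\
    (forall i, diam (U i) <= 1%:E) &
    \sum_(0 <= i <oo) diam_pow s (U i) < (theta / 2)%:E.
  have : hausdorff_premeasure s 1 E < (theta / 2)%:E.
    apply: (@le_lt_trans _ _ (hausdorff_measure s E)).
      by apply: ereal_sup_ubound; exists 1%R => //=.
    by rewrite H0 lte_fin divr_gt0.
  by move=> /ereal_inf_lt[_ [U HU <-] ?]; exists U.
pose w i : R := if U i == set0 then 0%R else (fine (diam (U i)) `^ s')%R.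
have w0 i : (0 <= w i)%R by rewrite /w; case: ifP => // _; exact: powR_ge0.
have wU i : (w i)%:E <= diam_pow s (U i).
  rewrite /w /diam_pow; case: ifPn => // /set0P U0.
  have [/andP[d0 d1] dE _] := diam_bounds U0 (dU i).
  rewrite dE poweR_EFin lee_fin /=; move: d0; rewrite le_eqVlt => /predU1P[<-|d0].
    by rewrite powR0 ?lt0r_neq0 // powR_ge0.
  by apply: ger_powR => //; rewrite d0.
have sum_w n : (\sum_(i < n) w i <= theta / 2)%R.
  rewrite -lee_fin; apply: le_trans (ltW sumU).
  apply: le_trans (nneseries_lim_ge n (fun i _ _ => diam_pow_ge0 s (U i))).
  rewrite big_mkord -sumEFin; apply: lee_sum => i _; exact: wU.
(* Sets of diameter 0 must also get a positive [d i]; the geometric series spends the other half of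
   [theta] on this. *)
pose v i : R := (w i + theta / 2 / 2 ^+ i.+1)%R.
have v0 i : (0 < v i)%R.
  by rewrite ltr_wpDl // !divr_gt0 // exprn_gt0.
pose d i : R := (v i `^ s'^-1)%R.
have dE i : (d i `^ s' = v i)%R.
  by rewrite /d -powRrM mulVf ?lt0r_neq0 // powRr1 // ltW.
have sum_d n : (\sum_(i < n) d i `^ s' <= theta)%R.
  rewrite (eq_bigr (fun i : 'I_n => w i + theta / 2 / 2 ^+ i.+1)%R) => [|i _]; last first.
    exact: dE.
  rewrite big_split /=.
  suff : (\sum_(i < n) theta / 2 / 2 ^+ i.+1 <= theta / 2)%R.
    by have := sum_w n; lra.
  rewrite -mulr_sumr ger_pMr ?divr_gt0 //.
  suff -> : (\sum_(i < n) (2 ^+ i.+1)^-1 = 1 - 2 ^- n :> R)%R.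
    by rewrite lerBlDr lerDl invr_ge0 exprn_ge0.
  elim: n => [|n IH]; first by rewrite big_ord0 expr0 invr1 subrr.
  rewrite big_ord_recr /= IH exprS; have := exp2_neq0 R n => ?.
  by field.
have U_diam i X Y : U i (Phi X) -> U i (Phi Y) -> forall j, (`|X j - Y j| <= d i)%R.
  move=> UX UY j; apply: le_trans (Phi_expanding X Y j) _.
  have U0 : U i !=set0 by exists (Phi X).
  have [/andP[d0 d1] _ dist] := diam_bounds U0 (dU i).
  apply: le_trans (dist _ _ UX UY) _.
  rewrite -[leLHS]powRr1 // -[X in (_ `^ X <= _)%R](divff (lt0r_neq0 s'0)).
  rewrite powRrM; apply: ge0_ler_powR; rewrite ?nnegrE ?powR_ge0 ?(ltW (v0 i)) //.
    by rewrite invr_ge0 ltW.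
  have -> : (fine (diam (U i)) `^ s' = w i)%R.
    by rewrite /w; case: ifPn => // /eqP Ui0; case: U0 => x; rewrite Ui0.
  by rewrite lerDl !divr_ge0 ?exprn_ge0 // ltW.
have [X [X01 WX nUX]] := @exists_limsup_avoiding R J s' theta d
  (fun i => [set X | U i (Phi X)]) s'0 s'N theta0 theta1
  (fun i => powR_gt0 _ (v0 i)) U_diam sum_d W W_dense.
have [i _ Ui] := EU _ (Phi_E X01 WX).
exact: nUX Ui.
Qed.

Lemma hausdorff_dim_ge_card : #|J|%:R%:E <= hausdorff_dim E.
Proof.
apply: le_ereal_inf_tmp => _ [s [s0 sE] <-]; rewrite lee_fin leNgt.
by apply/negP => sN; exact: hausdorff_measure_gt0 s0 sN sE.
Qed.

Lemma limsup_image_neq0 : (0 < #|J|)%N -> E !=set0.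
Proof.
move=> J0; apply/set0P; apply/eqP => E0; have := hausdorff_dim_ge_card.
by rewrite E0 => /le_trans/(_ hausdorff_dim_set0); rewrite lee_fin lern0 -leqn0 leqNgt J0.
Qed.

End hausdorff.

(** * Generic additional columns *)

Section strips.
Variable R : realType.

Lemma card_cover_le (T I : finType) (S : {set T}) (F : I -> {set T}) :
  (forall p, p \in S -> exists i, p \in F i) -> (#|S| <= \sum_i #|F i|)%N.
Proof.
move=> H; apply: (@leq_trans (\sum_(p in S) \sum_i (p \in F i))).
  rewrite -sum1_card; apply: leq_sum => p /H[i pi].
  by rewrite (bigD1 i) //= pi.
rewrite exchange_big /=; apply: leq_sum => i _.
rewrite -sum1_card big_mkcond [X in (_ <= X)%N]big_mkcond /=.
by apply: leq_sum => p _; case: (p \in S); case: (p \in F i).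
Qed.

(** The points [gam + del * p] run through an interval of length [del * q], near at most
    [del * q + 2] integers; each of these accounts for at most [2 * rho / del + 1] indices. *)
Lemma card_near_int_pos (q : nat) (gam del rho : R) :
  0 < del -> 0 < rho -> rho <= 2^-1 ->
  #|[set p : 'I_q | `[< exists a : int, `|gam + del * (p : nat)%:R + a%:~R| < rho >]]%SET|%:R
    <= (del * q%:R + 2) * (2 * rho / del + 1).
Proof.
move=> del0 rho0 rho2; set S := (X in #|X|%:R <= _).
pose y := - gam - del * q%:R - rho; pose a0 := Num.floor y.
have dq : 0 <= del * q%:R by rewrite mulr_ge0 // ltW.
pose K := (Num.trunc (del * q%:R + 1)).+1.
pose F (v : 'I_K) : {set 'I_q} :=
  [set p : 'I_q | `|gam + del * (p : nat)%:R + (a0 + 1 + v)%:~R| < rho]%SET.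
have FM v : #|F v|%:R <= 2 * rho / del + 1.
  apply: card_bounded_diff; first by rewrite divr_ge0 // ?mulr_ge0 // ltW.
  move=> p p'; rewrite !inE !ltr_norml => /andP[h1 h2] /andP[h3 h4].
  by rewrite ler_pdivlMr // mulrBl mulrC [X in _ - X]mulrC; lra.
have cov p : p \in S -> exists v, p \in F v.
  rewrite inE => /asboolP[a]; rewrite ltr_norml => /andP[h1 h2].
  have pq : del * (p : nat)%:R <= del * q%:R by rewrite ler_pM2l // ler_nat ltnW.
  have dp : 0 <= del * (p : nat)%:R by rewrite mulr_ge0 // ltW.
  have ya : y < a%:~R by rewrite /y; lra.
  have aa0 : a0 + 1 <= a.
    by rewrite lezD1 -(ltr_int R); apply: le_lt_trans ya; exact: floor_le.
  have ay : a%:~R < (a0 + 1)%:~R + (del * q%:R + 1).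
    by have := lt_succ_floor y; rewrite -/a0 /y; lra.
  have [w wE] : exists w : nat, a = a0 + 1 + w%:Z.
    by exists (absz (a - (a0 + 1))%R); lia.
  have wK : (w < K)%N.
    rewrite ltnS leqNgt; apply/negP => Dw.
    have := truncn_le_nat (del * q%:R + 1) w.-1.
    have w0 : (0 < w)%N by exact: leq_ltn_trans Dw.
    rewrite (prednK w0) -ltnS (prednK w0) Dw => /esym/idP.
    by move: ay; rewrite wE intrD ltrD2l => /lt_trans h /h; rewrite ltxx.
  exists (Ordinal wK); rewrite inE /= -wE ltr_norml; apply/andP; split; lra.
have := card_cover_le cov; rewrite -(ler_nat R) => /le_trans; apply.
rewrite natr_sum; apply: (@le_trans _ _ (\sum_(v < K) (2 * rho / del + 1))).
  by apply: ler_sum => v _; exact: FM.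
rewrite sumr_const card_ord -[leLHS]mulr_natl.
apply: ler_wpM2r; first by rewrite addr_ge0 // divr_ge0 // ?mulr_ge0 // ltW.
have := truncn_le (del * q%:R + 1); rewrite addr_ge0 // => /idP.
by rewrite /K -natr1; lra.
Qed.

Lemma card_near_int (q : nat) (gam del rho : R) :
  del != 0 -> 0 < rho -> rho <= 2^-1 ->
  #|[set p : 'I_q | `[< exists a : int, `|gam + del * (p : nat)%:R + a%:~R| < rho >]]%SET|%:R
    <= (`|del| * q%:R + 2) * (2 * rho / `|del| + 1).
Proof.
move=> del0 rho0 rho2; have [dp|dn] := ltrP 0 del.
  by rewrite (gtr0_norm dp); exact: card_near_int_pos.
have dn' : 0 < - del by rewrite oppr_gt0 lt_neqAle del0.
rewrite (ler0_norm dn); apply: le_trans (card_near_int_pos q (- gam) dn' rho0 rho2).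
rewrite ler_nat; apply/subset_leq_card/fintype.subsetP => p.
rewrite inE => /asboolP[a H]; rewrite inE; apply/asboolP; exists (- a).
have -> : - gam + - del * (p : nat)%:R + (- a)%:~R = - (gam + del * (p : nat)%:R + a%:~R).
  by rewrite mulrNz; ring.
by rewrite normrN.
Qed.

Variables (m r q : nat).
Let J : finType := ('I_m * 'I_r)%type.
Let F := {ffun J -> 'I_q}.

Definition column (j0 : 'I_r) (f : F) : {ffun 'I_m -> 'I_q} :=
  [ffun i => f (i, j0)].

Definition set_column (j0 : 'I_r) (f : F) (v : {ffun 'I_m -> 'I_q}) : F :=
  [ffun z => if z.2 == j0 then v z.1 else f z].

(* Exchanging the column j0 of f with v is an involution on the pairs (f, v). *)
Lemma card_by_columns (S : {set F}) (j0 : 'I_r) (M : R) :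
  (forall f, #|[set v | set_column j0 f v \in S]%SET|%:R <= M) ->
  #|S|%:R * q%:R ^+ m <= q%:R ^+ (m * r) * M.
Proof.
move=> H.
pose h (z : F * {ffun 'I_m -> 'I_q}) := (set_column j0 z.1 z.2, column j0 z.1).
have hK : involutive h.
  move=> [f v]; rewrite /h /=; congr (_, _).
    apply/ffunP => -[i j]; rewrite !ffunE /=.
    by case: eqP => [->|].
  by apply/ffunP => i; rewrite !ffunE eqxx.
have E : (\sum_(f : F) #|[set v | set_column j0 f v \in S]%SET| = #|S| * q ^ m)%N.
  transitivity (\sum_(z : F * {ffun 'I_m -> 'I_q}) ((h z).1 \in S : nat))%N.
    rewrite -(pair_big predT predT
      (fun f v => (set_column j0 f v \in S : nat))) /=.
    apply: eq_bigr => f _; rewrite -sum1_card big_mkcond /=.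
    by apply: eq_bigr => v _; rewrite inE; case: (_ \in S).
  rewrite -(reindex_inj (inv_inj hK) (P := predT)
    (F := fun z : F * {ffun 'I_m -> 'I_q} => (z.1 \in S : nat))) /=.
  rewrite -(pair_big predT predT (fun f _ => (f \in S : nat))) /=.
  rewrite -sum1_card big_distrl /= [RHS]big_mkcond /=; apply: eq_bigr => f _.
  rewrite sum_nat_const card_ffun !card_ord.
  by case: (f \in S); rewrite ?muln0 ?muln1 ?mul1n.
have := congr1 (fun u => u%:R : R) E; rewrite natrM natrX => <-.
rewrite natr_sum; apply: (@le_trans _ _ (\sum_(f : F) M)).
  by apply: ler_sum => f _; exact: H.
by rewrite sumr_const card_ffun card_prod !card_ord -[leLHS]mulr_natl natrX.
Qed.

(** With all columns but [j0] fixed, the [m] rows are independent and [card_near_int] applies to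
    each. As the step [l / q * |v j0|] is at most [rho], the summand 1 in that count is absorbed by
    turning the factor 2 into 3. *)
Lemma card_strips (x : J -> R) (l rho : R) (gam : 'I_m -> R) (v : 'I_r -> R) j0 :
  (0 < q)%N -> 0 < l -> 0 < rho -> rho <= 2^-1 -> 1 <= `|v j0| ->
  l / q%:R * `|v j0| <= rho ->
  #|[set f : F | `[< forall i, exists a : int,
      `|gam i + \sum_j grid x l f (i, j) * v j + a%:~R| < rho >]]%SET|%:R
  <= q%:R ^+ (m * r) * (3 * rho * (1 + 2 / (l * `|v j0|))) ^+ m.
Proof.
move=> q0 l0 rho0 rho2 v1 lv.
pose S : {set F} := [set f : F | `[< forall i, exists a : int,
    `|gam i + \sum_j grid x l f (i, j) * v j + a%:~R| < rho >]]%SET.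
rewrite -/S; have q0R : 0 < q%:R :> R by rewrite ltr0n.
have vn0 : v j0 != 0 by rewrite -normr_gt0; lra.
pose lam := l / q%:R; have lam0 : 0 < lam by rewrite divr_gt0.
pose M := (lam * `|v j0| * q%:R + 2) * (2 * rho / (lam * `|v j0|) + 1).
have lv0 : 0 < lam * `|v j0| by rewrite mulr_gt0 // normr_gt0.
have lv0' : 0 < l * `|v j0| by rewrite mulr_gt0 // normr_gt0.
have M0 : 0 <= M.
  by rewrite mulr_ge0 // addr_ge0 // ?divr_ge0 ?mulr_ge0 // ltW.
have MS : #|S|%:R * q%:R ^+ m <= q%:R ^+ (m * r) * M ^+ m.
  apply: (card_by_columns (j0 := j0)) => f.
  pose G i : R := gam i + \sum_(j | j != j0) grid x l f (i, j) * v j + x (i, j0) * v j0.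
  pose Si i : {set 'I_q} := [set p : 'I_q | `[< exists a : int,
    `|G i + lam * v j0 * (p : nat)%:R + a%:~R| < rho >]]%SET.
  apply: (@le_trans _ _ #|(family (fun i => mem (Si i)) : pred {ffun 'I_m -> 'I_q})|%:R).
    rewrite ler_nat; apply/subset_leq_card/fintype.subsetP => w.
    rewrite 2!inE => /asboolP H; apply/familyP => i; rewrite inE; apply/asboolP.
    have [a Ha] := H i; exists a; move: Ha; congr (`|_ + _| < _).
    have e : grid x l (set_column j0 f w) (i, j0) = x (i, j0) + lam * (w i : nat)%:R.
      by rewrite /grid ffunE eqxx.
    rewrite /G (bigD1 j0) //= e.
    have -> : \sum_(j | j != j0) grid x l (set_column j0 f w) (i, j) * v j =
        \sum_(j | j != j0) grid x l f (i, j) * v j.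
      by apply: eq_bigr => j jj0; rewrite /grid ffunE /= (negPf jj0).
    by ring.
  rewrite -[X in _ ^+ X](card_ord m); apply: card_family_le => // i.
  have := @card_near_int q (G i) (lam * v j0) rho.
  rewrite normrM (gtr0_norm lam0) => /(_ _ rho0 rho2); apply.
  by rewrite mulf_neq0 // lt0r_neq0.
have ME : M <= q%:R * (3 * rho * (1 + 2 / (l * `|v j0|))).
  have -> : q%:R * (3 * rho * (1 + 2 / (l * `|v j0|))) =
      (lam * `|v j0| * q%:R + 2) * (3 * rho / (lam * `|v j0|)).
    rewrite /lam; have := lt0r_neq0 l0; have := lt0r_neq0 q0R.
    have : `|v j0| != 0 by rewrite normr_eq0.
    by move=> ? ? ?; field; apply/and3P.
  apply: ler_wpM2l; first by rewrite addr_ge0 // mulr_ge0 // ltW.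
  have : 1 <= rho / (lam * `|v j0|) by rewrite ler_pdivlMr // mul1r.
  by rewrite -!mulrA; set u := rho / _; lra.
rewrite -(ler_pM2r (exprn_gt0 m q0R)). apply: le_trans MS _.
set mu := 3 * rho * _ in ME *.
have -> : q%:R ^+ (m * r) * mu ^+ m * q%:R ^+ m = q%:R ^+ (m * r) * (q%:R * mu) ^+ m.
  by rewrite [X in _ = _ * X]exprMn [X in _ = _ * X]mulrC mulrA.
apply: ler_wpM2l; first exact: exprn_ge0.
apply: lerXn2r; rewrite ?nnegrE //. by exact: le_trans M0 ME.
Qed.

End strips.

Section generic.
Variables (R : realType) (m k r : nat).
Let J : finType := ('I_m * 'I_r)%type.

Definition mx_of_fun (X : J -> R) : 'M[R]_(m, r) := \matrix_(i, j) X (i, j).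

Definition centered (T : nat) (v : 'I_(2 * T).+1) : int := (v : nat)%:Z - T%:Z.

Lemma centered_surj T (z : int) : (`|z| <= T)%N ->
  exists v : 'I_(2 * T).+1, centered v = z.
Proof.
move=> zT; have H : (absz (z + T%:Z)%R < (2 * T).+1)%N by lia.
by exists (Ordinal H); rewrite /centered /=; lia.
Qed.

Lemma centered_le T (v : 'I_(2 * T).+1) : `|centered v| <= T%:Z.
Proof. by have := ltn_ord v; rewrite /centered; lia. Qed.

(** Inside a cube of side [lam] with corner [Y] the residues vary by at most [c / 2 ^ (n x)], so
    twice this bound at [Y] suffices. Vectors with [b2 = 0] only see [A]. *)
Lemma separated_row_mx n (c : R) x (A : 'M[R]_(m, k)) (X Y : J -> R) (lam : R) :
  separated n c x A -> (forall j, Y j <= X j <= Y j + lam) ->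
  lam * r%:R * 2 ^+ (m * x) <= c / 2 ^+ (n * x) ->
  (forall (b1 : 'cV[int]_k) (b2 : 'cV[int]_r), b2 != 0 ->
    (height b1 <= 2 ^ (m * x))%N -> (height b2 <= 2 ^ (m * x))%N ->
    ~ forall i, exists a : int,
      `|\sum_j A i j * (b1 j ord0)%:~R + \sum_j Y (i, j) * (b2 j ord0)%:~R + a%:~R|
        < 2 * (c / 2 ^+ (n * x))) ->
  separated n c x (row_mx A (mx_of_fun X)).
Proof.
move=> sA XY lamT H b a b0 bx; rewrite -ler_pdivrMr ?exprn_gt0 //.
set e := c / _ in H lamT *.
pose b1 := usubmx b; pose b2 := dsubmx b.
have h1 : (height b1 <= 2 ^ (m * x))%N.
  by apply/height_leP => i; rewrite mxE; apply: (height_leP b _).1.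
have h2 : (height b2 <= 2 ^ (m * x))%N.
  by apply/height_leP => i; rewrite mxE; apply: (height_leP b _).1.
have resE : residue (row_mx A (mx_of_fun X)) b a =
    `|A *m map_mx intr b1 + mx_of_fun X *m map_mx intr b2 + map_mx intr a|.
  by rewrite /residue -{1}(vsubmxK b) map_col_mx mul_row_col.
have [b20|b2n] := eqVneq b2 0.
  have -> : residue (row_mx A (mx_of_fun X)) b a = residue A b1 a.
    by rewrite resE b20 map_mx0 mulmx0 addr0.
  rewrite /e ler_pdivrMr ?exprn_gt0 //; apply: sA => //.
  rewrite height_gt0; apply: contraTneq b0 => b10.
  by rewrite height_gt0 negbK -(vsubmxK b) -/b1 -/b2 b10 b20 col_mx0.
clearbody b1 b2; rewrite leNgt; apply/negP => small; apply: (H b1 b2 b2n h1 h2) => i.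
exists (a i ord0); rewrite (_ : 2 * e = e + e); last by rewrite mulr_natl.
have := mx_entry_le (A *m map_mx intr b1 + mx_of_fun X *m map_mx intr b2 + map_mx intr a) i ord0.
rewrite -resE => /le_lt_trans/(_ small); rewrite !mxE => small_i.
have e1 : \sum_j A i j * (b1 j ord0)%:~R =
    \sum_j A i j * (map_mx intr b1 : 'cV[R]_k) j ord0.
  by apply: eq_bigr => j _; rewrite mxE.
have e2 : \sum_j mx_of_fun X i j * (map_mx intr b2 : 'cV[R]_r) j ord0 =
    \sum_j Y (i, j) * (b2 j ord0)%:~R + \sum_j (X (i, j) - Y (i, j)) * (b2 j ord0)%:~R.
  rewrite -big_split /=; apply: eq_bigr => j _; rewrite !mxE; ring.
set D := \sum_j (X (i, j) - Y (i, j)) * _ in e2.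
have De : `|D| <= e.
  apply: le_trans lamT; apply: le_trans (ler_norm_sum _ _ _) _.
  rewrite -mulrA mulrCA mulr_natl -[X in _ *+ X](card_ord r) -sumr_const.
  apply: ler_sum => j _; rewrite normrM; apply: ler_pM => //.
    by have /andP[? ?] := XY (i, j); rewrite ger0_norm; lra.
  rewrite norm_intr -natrX ler_nat; exact: (height_leP b2 _).1.
move: small_i; rewrite e2 -e1; set S1 := \sum_j _; set S2 := \sum_j _.
rewrite (_ : S1 + S2 + (a i ord0)%:~R = (S1 + (S2 + D) + (a i ord0)%:~R) - D); last by ring.
move=> small_i; apply: le_lt_trans (ler_normB _ _) _.
exact: ltr_leD.
Qed.

(** The constant [c] must not depend on the cube. A pair [(b1, b2)] with some [|b2 j| * l > 1]
    spoils at most the share [(18 e) ^ m] of the subcubes, whatever [l] is, and there are at most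
    [(3 T) ^ n] pairs, where [e ^ m * T ^ n = c ^ m]. The remaining [b2] spoil more, depending on
    [l], but their number is bounded independently of [T], so a large scale makes them
    negligible. *)
Lemma generic_dense (A : 'M[R]_(m, k)) (c0 : R) : (0 < m)%N -> (0 < r)%N ->
  0 < c0 -> (forall x0, exists2 x, (x0 <= x)%N & separated (k + r) c0 x A) ->
  exists2 c, 0 < c & forall (Y : J -> R) l k0 q0, 0 < l -> l <= 1 ->
    exists q x (G : {set {ffun J -> 'I_q}}), [/\ (q0 <= q)%N, (k0 <= x)%N,
      (q ^ #|J| <= 2 * #|G|)%N & forall p, p \in G ->
        box (grid Y l p) (l / q%:R) `<=`
          [set X | separated (k + r) c x (row_mx A (mx_of_fun X))]].
Proof.
move=> m0 r0 c00 sA; set n := (k + r)%N in sA *.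
(* 18 bounds [3 * 2 * (1 + 2 / (l * |b2 j|))] when [l * |b2 j| > 1], and [3 ^+ n] comes from
   [2 T + 1 <= 3 T]; the 4 leaves at most a quarter of the subcubes to these pairs. *)
pose c1 : R := (4 * 3 ^+ n * 18 ^+ m)^-1.
have d1 : 1 <= 3 ^+ n * 18 ^+ m :> R.
  by rewrite -[leLHS]mulr1 ler_pM ?exprn_ege1 ?ler1n.
have c1_gt0 : 0 < c1 by rewrite invr_gt0 !mulr_gt0 ?exprn_gt0.
have c1_le : c1 <= 4^-1.
  by rewrite /c1 lef_pV2 ?posrE ?mulr_gt0 ?exprn_gt0 // -mulrA ler_peMr.
pose c := Num.min c0 c1.
have c_gt0 : 0 < c by rewrite lt_min c00.
have cc0 : c <= c0 by rewrite ge_min lexx.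
have cc1 : c <= c1 by rewrite ge_min lexx orbT.
have cm : 3 ^+ n * 18 ^+ m * c ^+ m <= 4^-1.
  have : c ^+ m <= c1.
    apply: (le_trans _ cc1); rewrite -(prednK m0) exprS ler_piMr ?(ltW c_gt0) //.
    apply: exprn_ile1; first exact: ltW.
    by apply: (le_trans cc1); apply: (le_trans c1_le); lra.
  move=> h; apply: le_trans (ler_wpM2l (le_trans ler01 d1) h) _.
  have dn0 : 3 ^+ n * 18 ^+ m != 0 :> R by rewrite lt0r_neq0 // (lt_le_trans ltr01).
  have -> : c1 = 4^-1 / (3 ^+ n * 18 ^+ m) by rewrite /c1 -mulrA invfM.
  by rewrite mulrCA divff // mulr1.
exists c => // Y l k0 q0 l0 l1.
pose V0 : R := 6 * (1 + 2 / l).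
have l2 : 0 <= 2 / l by rewrite divr_ge0 // ltW.
have V00 : 0 <= V0 by rewrite mulr_ge0 // addr_ge0.
(* [D / T ^+ r] will bound the share spoiled by the small [b2], hence the scale with
   [4 * D <= T]. *)
pose D : R := 3 ^+ k * (2 / l + 1) ^+ r * (V0 * c) ^+ m.
have D0 : 0 <= D by rewrite !mulr_ge0 ?exprn_ge0 ?addr_ge0 // mulr_ge0 // ltW.
have [x xk sx] := sA (maxn k0 (Num.bound (4 * D))).
pose T := (2 ^ (m * x))%N.
have TR : T%:R = 2 ^+ (m * x) :> R by rewrite natrX.
have T_gt0 : 0 < T%:R :> R by rewrite TR exprn_gt0.
have T1 : 1 <= T%:R :> R by rewrite TR exprn_ege1 // ler1n.
have TD : 4 * D <= T%:R.
  apply: le_trans (ltW (archi_boundP _)) _; first by rewrite mulr_ge0.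
  rewrite ler_nat; apply: leq_trans (leq_maxr k0 _) _; apply: leq_trans xk _.
  apply: (@leq_trans (2 ^ x)); first exact/ltnW/ltn_expl.
  by rewrite leq_exp2l // leq_pmull.
pose e : R := c / 2 ^+ (n * x).
have e_gt0 : 0 < e by rewrite divr_gt0 ?exprn_gt0.
have e_le : e <= 4^-1.
  apply: (@le_trans _ _ c); last exact: le_trans cc1 c1_le.
  by rewrite ler_pdivrMr ?exprn_gt0 // ler_peMr ?(ltW c_gt0) // exprn_ege1 // ler1n.
have eT : e ^+ m * T%:R ^+ n = c ^+ m.
  have E2 : (2 ^+ (n * x)) ^+ m = (2 ^+ (m * x)) ^+ n :> R.
    by rewrite -!exprM; congr (_ ^+ _); rewrite mulnAC [RHS]mulnAC [(m * n)%N]mulnC.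
  by rewrite TR /e expr_div_n E2 divfK // !expf_neq0.
pose q := (maxn q0 (Num.bound (l * r%:R * T%:R / e))).+1.
have q_gt0 : 0 < q%:R :> R by rewrite ltr0n.
have lamT : l / q%:R * r%:R * T%:R <= e.
  have lq : l * r%:R * T%:R / e <= q%:R.
    apply: le_trans (ltW (archi_boundP _)) _.
      by rewrite divr_ge0 ?mulr_ge0 // ltW.
    by rewrite ler_nat /q ltnW // ltnS leq_maxr.
  rewrite (_ : l / q%:R * r%:R * T%:R = l * r%:R * T%:R / q%:R); last by ring.
  by rewrite ler_pdivrMr // [leRHS]mulrC -ler_pdivrMr.
pose F := {ffun J -> 'I_q}.
pose I1 := {ffun 'I_k -> 'I_(2 * T).+1}; pose I2 := {ffun 'I_r -> 'I_(2 * T).+1}.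
pose gam (e1 : I1) i : R := \sum_j A i j * (centered (e1 j))%:~R.
pose Bad (e1 : I1) (e2 : I2) : {set F} :=
  if [forall j, centered (e2 j) == 0] then finset.set0 else
  [set f : F | `[< forall i, exists a : int,
    `|gam e1 i + \sum_j grid Y l f (i, j) * (centered (e2 j))%:~R + a%:~R| < 2 * e >]]%SET.
pose small (e2 : I2) := [forall j, (`|centered (e2 j)|%:~R * l <= 1 :> R)].
have cardJ : #|J| = (m * r)%N by rewrite card_prod !card_ord.
have e18 : 0 <= 18 * e by rewrite mulr_ge0 // ltW.
have eV : 0 <= V0 * e by rewrite mulr_ge0 // ltW.
have Bad_card e1 e2 : #|Bad e1 e2|%:R <= q%:R ^+ (m * r) *
    ((18 * e) ^+ m + (small e2)%:R * (V0 * e) ^+ m).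
  have rhs0 : 0 <= (18 * e) ^+ m + (small e2)%:R * (V0 * e) ^+ m.
    by rewrite addr_ge0 ?mulr_ge0 ?exprn_ge0.
  rewrite /Bad; case: ifPn => [_|]; first by rewrite cards0 mulr_ge0 ?exprn_ge0.
  have strips j0 : centered (e2 j0) != 0 -> #|[set f : F | `[< forall i, exists a : int,
    `|gam e1 i + \sum_j grid Y l f (i, j) * (centered (e2 j))%:~R + a%:~R| < 2 * e >]]%SET|%:R
    <= q%:R ^+ (m * r) *
      (3 * (2 * e) * (1 + 2 / (l * `|(centered (e2 j0))%:~R|))) ^+ m.
    move=> n0; apply: (@card_strips R m r q Y l (2 * e) (gam e1)
      (fun j => (centered (e2 j))%:~R) j0) => //.
    - by rewrite mulr_gt0.
    - by lra.
    - by rewrite -intr_norm -[X in X <= _]/(1%:~R) ler_int -gtz0_ge1 normr_gt0.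
    have cT : `|(centered (e2 j0))%:~R| <= T%:R :> R.
      by rewrite -intr_norm -[leRHS]/(T%:Z%:~R) ler_int centered_le.
    apply: le_trans (ler_wpM2l _ cT) _; first by rewrite divr_ge0 // ltW.
    have : l / q%:R * T%:R <= l / q%:R * r%:R * T%:R.
      rewrite [leRHS]mulrAC ler_peMr ?ler1n // mulr_ge0 ?divr_ge0 //; exact: ltW.
    by have := e_gt0; lra.
  move=> /forallPn[j1 j1n].
  have [sm|/forallPn[j0 j0n]] := boolP (small e2).
    apply: le_trans (strips j1 j1n) _; rewrite ler_wpM2l ?exprn_ge0 // mul1r.
    apply: (@le_trans _ _ ((V0 * e) ^+ m)); last first.
      by rewrite lerDr exprn_ge0.
    have c1R : 1 <= `|(centered (e2 j1))%:~R| :> R.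
      by rewrite -intr_norm -[X in X <= _]/(1%:~R) ler_int -gtz0_ge1 normr_gt0.
    have lv : 0 < l * `|(centered (e2 j1))%:~R| by rewrite mulr_gt0 // (lt_le_trans ltr01).
    have : 2 / (l * `|(centered (e2 j1))%:~R|) <= 2 / l.
      by rewrite ler_wpM2l // lef_pV2 ?posrE // ler_peMr // ltW.
    have : 0 <= 2 / (l * `|(centered (e2 j1))%:~R|) by rewrite divr_ge0 // ltW.
    rewrite /V0; set u := 2 / (l * _); set w := 2 / l => u0 uw.
    have P0 : 0 <= 3 * (2 * e) * (1 + u) by have := e_gt0; nra.
    have P : 3 * (2 * e) * (1 + u) <= 6 * (1 + w) * e by have := e_gt0; nra.
    by apply: lerXn2r => //; rewrite nnegrE //; exact: le_trans P0 P.
  move: j0n; rewrite -ltNge => j0n.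
  have n0 : centered (e2 j0) != 0.
    by apply: contraTneq j0n => ->; rewrite normr0 mul0r -leNgt.
  apply: le_trans (strips j0 n0) _; rewrite ler_wpM2l ?exprn_ge0 //.
  apply: (@le_trans _ _ ((18 * e) ^+ m)); last first.
    by rewrite lerDl mulr_ge0 ?exprn_ge0.
  have lv : 1 < l * `|(centered (e2 j0))%:~R| by rewrite mulrC -intr_norm.
  have : 2 / (l * `|(centered (e2 j0))%:~R|) <= 2.
    by rewrite ler_pdivrMr ?(lt_trans ltr01) // ler_peMr // ltW.
  have : 0 <= 2 / (l * `|(centered (e2 j0))%:~R|).
    by rewrite divr_ge0 // ltW // (lt_trans ltr01).
  set u := 2 / _ => u0 u2.
  have P0 : 0 <= 3 * (2 * e) * (1 + u) by have := e_gt0; nra.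
  have P : 3 * (2 * e) * (1 + u) <= 18 * e by have := e_gt0; nra.
  by apply: lerXn2r => //; rewrite nnegrE //; exact: le_trans P0 P.
pose G : {set F} := [set f : F | `[< box (grid Y l f) (l / q%:R) `<=`
  [set X | separated n c x (row_mx A (mx_of_fun X))] >]]%SET.
have cov f : f \in (~: G)%SET -> exists z : I1 * I2, f \in Bad z.1 z.2.
  rewrite inE; apply: contraNP => nz; rewrite inE; apply/asboolP => X bX.
  have sx' : separated n c x A.
    by move=> b a b0 bx; apply: le_trans cc0 _; exact: sx.
  apply: (separated_row_mx sx' bX); first by rewrite -TR.
  move=> b1 b2 b2n h1 h2 H; apply: nz.
  have /choice[e1 e1P] : forall j, exists v : 'I_(2 * T).+1, centered v = b1 j ord0.
    by move=> j; apply: centered_surj; exact: (height_leP b1 _).1.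
  have /choice[e2 e2P] : forall j, exists v : 'I_(2 * T).+1, centered v = b2 j ord0.
    by move=> j; apply: centered_surj; exact: (height_leP b2 _).1.
  exists (finfun e1, finfun e2) => /=; rewrite /Bad ifF; last first.
    apply/negbTE/forallPn; apply: contrapT => nj; move/eqP: b2n; apply.
    apply/matrixP => j j'; rewrite (ord1 j') mxE; apply: contrapT => /eqP nb.
    by apply: nj; exists j; rewrite ffunE e2P.
  rewrite inE; apply/asboolP => i; have [a Ha] := H i; exists a.
  move: Ha; congr (`|_ + _ + _| < _); apply: eq_bigr => j _;
    by rewrite ffunE ?e1P ?e2P.
have small_card : #|[set e2 | small e2]%SET|%:R <= (2 / l + 1) ^+ r.
  pose S : {set 'I_(2 * T).+1} :=
    [set v : 'I_(2 * T).+1 | (`|centered v|%:~R * l <= 1 :> R)]%SET.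
  apply: (@le_trans _ _ #|(family (fun=> mem S) : pred {ffun 'I_r -> 'I_(2 * T).+1})|%:R).
    rewrite ler_nat; apply/subset_leq_card/fintype.subsetP => e2.
    by rewrite inE => /forallP H; apply/familyP => j; rewrite inE; exact: H.
  rewrite -[X in _ ^+ X](card_ord r); apply: card_family_le; first by rewrite addr_ge0.
  move=> _; apply: card_bounded_diff => // v w; rewrite !inE => hv hw.
  rewrite ler_pdivlMr //.
  have : (centered v)%:~R <= `|centered v|%:~R :> R by rewrite ler_int ler_norm.
  have : - (centered w)%:~R <= `|centered w|%:~R :> R.
    by rewrite -mulrNz ler_int -normrN ler_norm.
  rewrite /centered !intrB => h1 h2.
  have h3 : v%:R - w%:R <= `|centered v|%:~R + `|centered w|%:~R :> R by lra.
  apply: le_trans (ler_wpM2r (ltW l0) h3) _; rewrite mulrDl; lra.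
have main : #|(~: G)%SET|%:R * 2 <= q%:R ^+ (m * r) :> R.
  have := card_cover_le cov; rewrite -(ler_nat R) natr_sum.
  rewrite -(pair_big predT predT (fun e1 e2 => #|Bad e1 e2|%:R)) /= => cG.
  pose B : R := (18 * e) ^+ m; pose V : R := (V0 * e) ^+ m.
  have V_ge0 : 0 <= V by exact: exprn_ge0.
  have B_ge0 : 0 <= B by exact: exprn_ge0.
  have T3 : (2 * T).+1%:R <= 3 * T%:R :> R.
    by rewrite -natr1 natrM; lra.
  have inner e1 : \sum_e2 #|Bad e1 e2|%:R <= q%:R ^+ (m * r) *
      ((3 * T%:R) ^+ r * B + (2 / l + 1) ^+ r * V).
    apply: le_trans (ler_sum _ (fun e2 _ => Bad_card e1 e2)) _.
    rewrite -mulr_sumr ler_wpM2l ?exprn_ge0 // big_split /=; apply: lerD.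
      rewrite sumr_const card_ffun !card_ord -[leLHS]mulr_natl natrX.
      by rewrite ler_wpM2r // lerXn2r ?nnegrE // mulr_ge0.
    rewrite -mulr_suml ler_wpM2r // -natr_sum; apply: le_trans small_card.
    rewrite ler_nat -sum1_card [X in (_ <= X)%N]big_mkcond /=.
    by apply: leq_sum => e2 _; rewrite inE; case: (small e2).
  have outer : #|(~: G)%SET|%:R <= (3 * T%:R) ^+ k * (q%:R ^+ (m * r) *
      ((3 * T%:R) ^+ r * B + (2 / l + 1) ^+ r * V)).
    apply: le_trans cG _; apply: le_trans (ler_sum _ (fun e1 _ => inner e1)) _.
    rewrite sumr_const card_ffun !card_ord -[leLHS]mulr_natl natrX.
    apply: ler_wpM2r; last by apply: lerXn2r => //; rewrite nnegrE ?mulr_ge0.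
    apply: mulr_ge0; first exact: exprn_ge0.
    have T3_ge0 : 0 <= 3 * T%:R :> R by rewrite mulr_ge0.
    have l3 : 0 <= 2 / l + 1 by rewrite addr_ge0.
    by apply: addr_ge0; apply: mulr_ge0 => //; exact: exprn_ge0.
  have first_le : (3 * T%:R) ^+ k * ((3 * T%:R) ^+ r * B) <= 4^-1.
    have -> : (3 * T%:R) ^+ k * ((3 * T%:R) ^+ r * B) =
        3 ^+ n * 18 ^+ m * (e ^+ m * T%:R ^+ n).
      by rewrite /n !exprD /B !exprMn; ring.
    by rewrite eT.
  have second_le : (3 * T%:R) ^+ k * ((2 / l + 1) ^+ r * V) <= 4^-1.
    have Tr : T%:R <= T%:R ^+ r :> R by rewrite ler_eXnr.
    have Tr0 : 0 < T%:R ^+ r :> R by rewrite exprn_gt0.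
    have -> : (3 * T%:R) ^+ k * ((2 / l + 1) ^+ r * V) = D / T%:R ^+ r.
      apply: (canRL (mulfK (lt0r_neq0 Tr0))); rewrite /D [X in _ = _ * X]exprMn -eT.
      by rewrite /n exprD /V !exprMn; ring.
    rewrite ler_pdivrMr //; lra.
  have -> : q%:R ^+ (m * r) = (4^-1 + 4^-1) * q%:R ^+ (m * r) * 2 :> R by field.
  rewrite ler_pM2r //; apply: le_trans outer _.
  rewrite mulrCA mulrC ler_wpM2r ?exprn_ge0 // mulrDr; exact: lerD.
exists q, x, G; split.
- by rewrite /q ltnW // ltnS leq_maxl.
- by apply: leq_trans xk; exact: leq_maxl.
- have := cardsC G; rewrite card_ffun cardJ card_ord => GE.
  move: main; rewrite -natrX -natrM ler_nat -GE.
  by clear; move: #|G| #|(~: G)%SET| => u v; lia.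
- by move=> p; rewrite inE => /asboolP.
Qed.

End generic.

(** * Assembly *)

Section assembly.
Variable R : realType.

Lemma residue_shift m k (A : 'M[R]_(m, k)) (Z : 'M[int]_(m, k)) b a :
  residue (A + map_mx intr Z) b a = residue A b (Z *m b + a).
Proof. by rewrite /residue mulmxDl map_mxD map_mxM addrA. Qed.

Lemma special_shift m n k eps (A : 'M[R]_(m, k)) (Z : 'M[int]_(m, k)) :
  special n eps A -> special n eps (A + map_mx intr Z).
Proof.
have shift b a : residue (A + map_mx intr Z) b (a - Z *m b) = residue A b a.
  by rewrite residue_shift addrC subrK.
move=> [[x0 cA] wA [c c0 sA]]; split.
- exists x0 => x /cA[b [a [b0 bx ba]]]; exists b, (a - Z *m b).
  by rewrite shift.
- move=> eta x1 eta0; have [x xx [b [a [b0 bx ba]]]] := wA eta x1 eta0.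
  by exists x => //; exists b, (a - Z *m b); rewrite shift.
- exists c => // x1; have [x xx sx] := sA x1; exists x => // b a b0 bx.
  by rewrite residue_shift; exact: sx.
Qed.

Lemma height_col_mx0 k r (b : 'cV[int]_k) :
  height (col_mx b (0 : 'cV[int]_r)) = height b.
Proof.
apply/eqP; rewrite eqn_leq; apply/andP; split; apply/height_leP => i.
  rewrite mxE; case: splitP => j _; last by rewrite mxE.
  exact: (height_leP b _).1.
have := (height_leP (col_mx b (0 : 'cV[int]_r)) _).1 (leqnn _) (lshift r i).
by rewrite col_mxEu.
Qed.

Lemma residue_row_mx0 m k r (A : 'M[R]_(m, k)) (X : 'M[R]_(m, r)) b a :
  residue (row_mx A X) (col_mx b 0) a = residue A b a.
Proof. by rewrite /residue map_col_mx mul_row_col map_mx0 mulmx0 addr0. Qed.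

Lemma special_row_mx m n k r eps c (A : 'M[R]_(m, k)) (X : 'M[R]_(m, r)) :
  special n eps A -> 0 < c ->
  (forall x0, exists2 x, (x0 <= x)%N & separated n c x (row_mx A X)) ->
  special n eps (row_mx A X).
Proof.
move=> [[x0 cA] wA _] c0 sX; split; last by exists c.
- exists x0 => x /cA[b [a [b0 bx ba]]]; exists (col_mx b 0), a.
  by rewrite height_col_mx0 residue_row_mx0.
- move=> eta x1 eta0; have [x xx [b [a [b0 bx ba]]]] := wA eta x1 eta0.
  by exists x => //; exists (col_mx b 0), a; rewrite height_col_mx0 residue_row_mx0.
Qed.

(** Diagonal dominance: for [v] in the left kernel, the column of an entry of [v] of maximal size
    would give [K * |v| <= m * M * |v|]. *)
Lemma row_free_add_pid_mx m n (B : 'M[R]_(m, n)) (M K : R) : (m <= n)%N ->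
  (forall i j, `|B i j| <= M) -> m%:R * M < K -> row_free (B + K *: pid_mx m).
Proof.
move=> mn BM MK; set C := B + _.
suff inj (v : 'rV[R]_m) : v *m C = 0 -> v = 0.
  rewrite -kermx_eq0; apply/eqP/row_matrixP => i; rewrite row0; apply: inj.
  by rewrite -row_mul mulmx_ker row0.
move=> vC; apply/eqP; apply: contraT => v0; exfalso.
have [i [j vE]] := mx_entry_normE v0; rewrite (ord1 i) in vE.
have v_gt0 : 0 < `|v| by rewrite normr_gt0.
have [j' j'E] : exists j' : 'I_n, j' = j :> nat by exists (widen_ord mn j).
have vP : (v *m (K *: pid_mx m)) ord0 j' = K * v ord0 j.
  rewrite mxE (bigD1 j) //= !mxE j'E eqxx ltn_ord mulr1 mulrC big1 ?addr0 // => l lj.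
  rewrite !mxE j'E (_ : (l == j :> nat) = false) ?mulr0 //.
  by apply/negbTE.
have : (v *m B) ord0 j' = - (K * v ord0 j).
  apply/eqP; rewrite -addr_eq0 -vP; apply/eqP.
  by have /matrixP/(_ ord0 j') := vC; rewrite mulmxDr !mxE.
move=> /(congr1 (fun z => `|z|)); rewrite normrN normrM -vE => vB.
have : `|(v *m B) ord0 j'| <= m%:R * M * `|v|.
  rewrite mxE; apply: le_trans (ler_norm_sum _ _ _) _.
  rewrite -mulrA mulr_natl -[X in _ *+ X](card_ord m) -sumr_const.
  apply: ler_sum => l _; rewrite normrM mulrC; apply: ler_pM => //.
  exact: mx_entry_le.
apply/negP; rewrite vB -ltNge ltr_pM2r //; apply: lt_le_trans MK _.
exact: ler_norm.
Qed.

Lemma mxrank_add_pid_mx m n (B : 'M[R]_(m, n)) (M K : R) :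
  (forall i j, `|B i j| <= M) -> (m + n)%:R * M < K ->
  \rank (B + K *: pid_mx (minn m n))%R = minn m n.
Proof.
move=> BM MK; have [m0|m_gt0] := posnP m.
  by subst m; apply/eqP; rewrite min0n -leqn0 rank_leq_row.
have [n0|n_gt0] := posnP n.
  by subst n; apply/eqP; rewrite minn0 -leqn0 rank_leq_col.
have M0 : 0 <= M by apply: le_trans (BM (Ordinal m_gt0) (Ordinal n_gt0)).
have [mn|/ltnW nm] := leqP m n.
  apply/eqP; apply: (row_free_add_pid_mx mn BM); apply: le_lt_trans MK.
  by rewrite ler_wpM2r // ler_nat leq_addr.
rewrite -mxrank_tr linearD linearZ /= tr_pid_mx; apply/eqP.
apply: (row_free_add_pid_mx nm (M := M)); first by move=> i j; rewrite mxE.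
apply: le_lt_trans MK; by rewrite ler_wpM2r // ler_nat leq_addl.
Qed.

Lemma special_FS m n eps (Omega : 'M[R]_(m, n)) : (0 < m)%N -> (0 < n)%N ->
  special n eps Omega -> (eps%:E < @dirichlet_const R m n)%E -> FS R m n Omega.
Proof.
move=> m0 n0 [[x0 cO] wO [c c0 sO]] epsD; split.
  exact: le_lt_trans (Theta_sup_le m0 cO) epsD.
case=> [|S0].
  by rewrite /Bad /= ltNge (Theta_inf_le0 m0 wO).
by have := le_Theta_sup m0 n0 sO; rewrite S0 lee_fin leNgt c0.
Qed.

(** The target [E] is left abstract because it takes two values: the special matrices themselves, to
    bound the Dirichlet constant from below, and the full-rank part of [FS]. *)
Lemma special_block m k r eps (A : 'M[R]_(m, k)) (E : set 'M[R]_(m, k + r)) :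
  (0 < m)%N -> special (k + r) eps A ->
  (forall Omega, special (k + r) eps Omega -> \rank Omega = minn m (k + r) ->
    E Omega) ->
  E !=set0 /\ ((m * r)%:R%:E <= hausdorff_dim E)%E.
Proof.
move=> m0 spA EP; have [_ _ [c0 c00 sA]] := spA.
pose M : R := `|A| + 1; have M0 : 0 <= M by rewrite addr_ge0.
pose K := Num.bound ((m + (k + r))%:R * M).
have KM : (m + (k + r))%:R * M < K%:R by apply: archi_boundP; rewrite mulr_ge0.
pose Z : 'M[int]_(m, k + r) := K%:Z *: pid_mx (minn m (k + r)).
have ZE : map_mx intr Z = K%:R *: pid_mx (minn m (k + r)) :> 'M[R]_(m, k + r).
  by rewrite /Z map_mxZ map_pid_mx.
pose Phi (X : 'I_m * 'I_r -> R) : 'M[R]_(m, k + r) :=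
  row_mx A (mx_of_fun X) + map_mx intr Z.
have PhiE c X : (forall j, 0 <= X j <= 1) -> 0 < c ->
    (forall x0, exists2 x, (x0 <= x)%N &
      separated (k + r) c x (row_mx A (mx_of_fun X))) -> E (Phi X).
  move=> X01 cX0 sX; apply: EP.
    by apply: special_shift; exact: special_row_mx cX0 sX.
  rewrite /Phi ZE; apply: (mxrank_add_pid_mx _ KM) => i j.
  rewrite mxE; case: splitP => l _.
    by rewrite (le_trans (mx_entry_le A i l)) // lerDl.
  rewrite mxE; have /andP[h1 h2] := X01 (i, l).
  by rewrite ger0_norm // (le_trans h2) // lerDr.
(* Without free columns the shifted [A] itself is the witness, and the claimed dimension is 0. *)
have [r0|r_gt0] := posnP r.
  split; last first.
    have -> : (m * r = 0)%N by rewrite r0 muln0.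
    exact: hausdorff_dim_ge0.
  exists (Phi (fun=> 0)); apply: (PhiE c0) => //.
    by move=> j; rewrite lexx ler01.
  move=> x0; have [x xx sx] := sA x0; exists x => //.
  apply: (separated_row_mx sx (Y := fun=> 0) (lam := 0)).
  - by move=> j; rewrite addr0 lexx.
  - by rewrite !mul0r divr_ge0 ?exprn_ge0 // ltW.
  move=> b1 b2 /eqP[]; apply/matrixP => i; exfalso.
  by have := ltn_ord i; lia.
have [c c_gt0 dense] := generic_dense m0 r_gt0 c00 sA.
have cardJ : #|{: 'I_m * 'I_r}| = (m * r)%N by rewrite card_prod !card_ord.
have expanding X Y j : `|X j - Y j| <= `|Phi X - Phi Y|.
  have := mx_entry_le (Phi X - Phi Y) j.1 (rshift k j.2).
  rewrite {1}/Phi {1}/Phi opprD addrACA subrr addr0 opp_row_mx add_row_mx row_mxEr.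
  by rewrite !mxE -!surjective_pairing.
have PhiW X : (forall j, 0 <= X j <= 1) ->
    (forall k0, exists2 x, (k0 <= x)%N &
      [set X | separated (k + r) c x (row_mx A (mx_of_fun X))] X) -> E (Phi X).
  by move=> X01; exact: PhiE.
split; first by apply: (limsup_image_neq0 dense expanding PhiW); rewrite cardJ muln_gt0 m0.
by rewrite -cardJ; exact: (hausdorff_dim_ge_card dense expanding PhiW).
Qed.

(** The [k] special columns cost [m * k] dimensions: [2 * m] when [m <= n], and only [m] when
    [n < m]. *)
Lemma exists_special_block m n : (0 < m)%N -> (0 < n)%N ->
  ~ (m = 1%N /\ n = 1%N) ->
  exists k r, [/\ n = (k + r)%N, (m * n <= m * r + 2 * maxn m n)%N &
    forall L, (1 <= L)%N -> exists A : 'M[R]_(m, k), special n (2 * 2 ^- L) A].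
Proof.
case: m => // -[|m] _ n0 mn; [|have [mn'|nm] := leqP m.+2 n].
- have n2 : (2 <= n)%N by rewrite ltn_neqAle n0 andbT; apply/eqP => n1; apply: mn.
  exists 2%N, (n - 2)%N; split; [by rewrite subnKC|by lia|].
  by move=> L; exact: exists_special_row.
- exists 2%N, (n - 2)%N; split; first by rewrite subnKC // (leq_trans _ mn').
    have := leq_maxl m.+2 n.
    have -> : (m.+2 * n = m.+2 * (n - 2) + m.+2 * 2)%N.
      by rewrite -mulnDr subnK // (leq_trans _ mn').
    by move: (m.+2 * (n - 2))%N => u; lia.
  by move=> L; exact: exists_special_diag.
- exists 1%N, (n - 1)%N; split; first by rewrite subnKC.
    by rewrite -[X in (_ * X <= _)%N](subnK n0) mulnDr leq_add2l muln1; lia.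
  by move=> L _; exact: exists_special_col.
Qed.

End assembly.

Theorem theorem3p1 (R : realType) (m n : nat)
    (m_gt0 : (0 < m)%N) (n_gt0 : (0 < n)%N)
    (mn_neq11 : ~ (m = 1%N /\ n = 1%N))
    (mn_neq23 : ~ (m = 2%N /\ n = 3%N \/ m = 3%N /\ n = 2%N)) :
  [/\ FS R m n !=set0,
      (((m * n)%:R - 2 * (maxn m n)%:R)%:E <= hausdorff_dim (FS R m n))%E,
      FS_full_rank R m n !=set0 &
      (((m * n)%:R - 2 * (maxn m n)%:R)%:E
         <= hausdorff_dim (FS_full_rank R m n))%E].
Proof.
have [k [r [nE dim_le exA]]] := exists_special_block R m_gt0 n_gt0 mn_neq11.
subst n.
have [A1 spA1] := exA 1%N isT.
have [E_n0 _] := special_block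
  (E := [set Omega | special (k + r) (2 * 2 ^- 1) Omega]) m_gt0 spA1 (fun _ h _ => h).
have [Xi [_ _ [c c0 sO]]] := E_n0.
have cD : (c%:E <= @dirichlet_const R m (k + r))%E.
  apply: le_trans (le_Theta_sup m_gt0 n_gt0 sO) _.
  by apply: ereal_sup_ubound; exists Xi.
have [L HL] := @exp2N_arbitrarily_small R (c / 4) (divr_gt0 c0 (ltr0Sn R 3)).
have [A spA] := exA L.+1 isT.
have epsD : ((2 * 2 ^- L.+1)%:E < @dirichlet_const R m (k + r))%E.
  apply: lt_le_trans cD; rewrite lte_fin.
  by have := HL L.+1 (leqnSn L); lra.
have [full_n0 full_dim] : FS_full_rank R m (k + r) !=set0 /\
    ((m * r)%:R%:E <= hausdorff_dim (FS_full_rank R m (k + r)))%E.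
  apply: (special_block m_gt0 spA) => Omega spO rkO; split => //.
  exact: special_FS m_gt0 n_gt0 spO epsD.
have dimR : (((m * (k + r))%:R - 2 * (maxn m (k + r))%:R)%:E <=
    hausdorff_dim (FS_full_rank R m (k + r)))%E.
  apply: le_trans full_dim; rewrite lee_fin lerBlDr -natrM -natrD ler_nat.
  exact: dim_le.
have sub : FS_full_rank R m (k + r) `<=` FS R m (k + r) by move=> Omega [].
split => //; first by have [A0 FA] := full_n0; exists A0; exact: sub.
exact: le_trans dimR (le_hausdorff_dim sub).
Qed.
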